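(* Assume that $\mathcal V$ is continuous on $\partial\mathcal T$ and that either (SC1) or (SC2) holds. Then $\mathcal V$ is continuous in its domain $Dom(\mathcal V)$ and $\lim_{x\to\bar x}\mathcal V(x)=+\infty$ for every $\bar x\in\partial Dom(\mathcal V)$.
   Context: Standing setting. $A\subset\mathbb R^m$ is compact; the target $\mathcal T\subset\mathbb R^n$ is closed with compact boundary; $\mathcal T^c=\mathbb R^n\setminus\mathcal T$, $\overset{\circ}{\mathcal T}$ is the interior of $\mathcal T$, $\mathbf d(x)=\mathrm{dist}(x,\mathcal T)$, $\mathbb R_+=[0,+\infty[$. The functions $f:\mathbb R^n\times A\to\mathbb R^n$ and $l:\mathbb R^n\times A\to\mathbb R_+$ are continuous; there is $M>0$ with $|f(x,a)|\le M(1+|x|)$ for all $(x,a)$, and for every $R>0$ there is $L_R>0$ with $|f(x_1,a)-f(x_2,a)|\le L_R|x_1-x_2|$ and $|l(x_1,a)-l(x_2,a)|\le L_R|x_1-x_2|$ whenever $|x_1|,|x_2|\le R$, $a\in A$. $\mathcal A$ is the set of measurable controls $\alpha:\mathbb R_+\to A$, and $y_x(\cdot,\alpha)$ is the solution on $\mathbb R_+$ of $\dot y(t)=f(y(t),\alpha(t))$, $y(0)=x$. Put $t_x(\alpha)=\inf\{t\ge0: y_x(t,\alpha)\in\mathcal T\}\le+\infty$ and $\mathcal A(x)=\{\alpha\in\mathcal A:\ \liminf_{t\to t_x(\alpha)^-}\mathbf d(y_x(t,\alpha))=0\}$. For $x\in\mathcal T^c$, $\mathcal V(x)=\inf_{\alpha\in\mathcal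 A(x)}\int_0^{t_x(\alpha)}l(y_x(t,\alpha),\alpha(t))\,dt$ (with $\inf\emptyset=+\infty$); $\mathcal V=0$ on $\mathcal T$. ''Continuous on $\partial\mathcal T$'' means continuous at each point of $\partial\mathcal T$ as a function on $\mathbb R^n\setminus\overset{\circ}{\mathcal T}$. $Dom(\mathcal V)=\{x\in\mathbb R^n\setminus\overset{\circ}{\mathcal T}:\mathcal V(x)<+\infty\}$, and $\partial Dom(\mathcal V)$ is its boundary relative to $\mathbb R^n\setminus\overset{\circ}{\mathcal T}$. (SC1): there exist $U:\mathbb R^n\setminus\overset{\circ}{\mathcal T}\to\mathbb R_+$ of class $C^1$ in $\mathbb R^n\setminus\overset{\circ}{\mathcal T}$, positive definite ($U>0$ on $\mathcal T^c$, $U=0$ on $\partial\mathcal T$) and proper ($U^{-1}(K)$ compact for every compact $K\subset\mathbb R_+$) on $\mathcal T^c$, and a continuous increasing $m:\,]0,+\infty[\,\to\,]0,+\infty[$ such that $\sup_{a\in A}\langle\nabla U(x),f(x,a)\rangle\le-m(\mathbf d(x))$ for all $x\in\mathcal T^c$. (SC2): there is a continuous increasing $c_2:\,]0,+\infty[\,\to\,]0,+\infty[$ with $l(x,a)\ge c_2(\mathbf d(x))$ for all $(x,a)\in\mathcal T^c\times A$. *)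

(* Defs.v *)
From HB Require Import structures.
From mathcomp Require Import all_boot all_order all_algebra.
From mathcomp Require Import all_classical all_reals all_analysis.

Set Implicit Arguments.
Unset Strict Implicit.
Unset Printing Implicit Defensive.

Import Order.TTheory GRing.Theory Num.Theory.
Import numFieldNormedType.Exports.

Local Open Scope classical_set_scope.
Local Open Scope ring_scope.

(* The norm that the library puts on ['rV[R]_n] is the sup
   norm; it is used here for the topology only. Every metric quantity is
   Euclidean. *)

Definition dotp (R : realType) (n : nat) (u v : 'rV[R]_n) : R :=
  \sum_(i < n) u 0 i * v 0 i.

Definition enorm (R : realType) (n : nat) (u : 'rV[R]_n) : R :=
  Num.sqrt (dotp u u).

Definition boundary (X : topologicalType) (S : set X) : set X :=
  closure S `\` interior S.

Definition rel_boundary (X : topologicalType) (S D : set X) : set X :=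
  S `&` closure D `&` closure (S `\` D).

Definition continuous_at_in (X Y : topologicalType) (S : set X) (g : X -> Y)
  (x : X) : Prop := g z @[z --> within S (nbhs x)] --> g x.

(* Extended-valued so that the distance to the empty set is +oo. *)
Definition dist (R : realType) (n : nat) (T : set 'rV[R]_n) (x : 'rV[R]_n)
  : \bar R := ereal_inf [set (enorm (x - z))%:E | z in T].

(* The filter of t -> s^-, with s possibly +oo. *)
Definition left_nbhs (R : realType) (s : \bar R) : set_system R :=
  match s with
  | r%:E => r^'-
  | +oo%E => +oo
  | -oo%E => setT
  end.

Definition is_control (R : realType) (m : nat) (A : set 'rV[R]_m)
  (alpha : R -> 'rV[R]_m) : Prop :=
  (forall t, 0 <= t -> A (alpha t)) /\
  (forall i, measurable_fun (`[0, +oo[%classic : set R) (fun t => alpha t 0 i)).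

(* Caratheodory solutions on [0, +oo[ of y' = f(y, alpha), y(0) = x. *)
Definition is_solution (R : realType) (n m : nat)
  (f : 'rV[R]_n -> 'rV[R]_m -> 'rV[R]_n)
  (x : 'rV[R]_n) (alpha : R -> 'rV[R]_m) (y : R -> 'rV[R]_n) : Prop :=
  {within (`[0, +oo[%classic : set R), continuous y} /\
  forall t, 0 <= t -> forall i : 'I_n,
    lebesgue_measure.-integrable (`[0, t]%classic : set R)
      (fun s => (f (y s) (alpha s) 0 i)%:E) /\
    y t 0 i = x 0 i + \int[lebesgue_measure]_(s in `[0, t]%classic)
                        f (y s) (alpha s) 0 i.

(* The solution is unique only on [0, +oo[; no definition below looks at its
   values at negative times. *)
Definition trajectory (R : realType) (n m : nat)
  (f : 'rV[R]_n -> 'rV[R]_m -> 'rV[R]_n)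
  (x : 'rV[R]_n) (alpha : R -> 'rV[R]_m) : R -> 'rV[R]_n :=
  xget (fun=> x) (is_solution f x alpha).

Definition exit_time (R : realType) (n m : nat)
  (f : 'rV[R]_n -> 'rV[R]_m -> 'rV[R]_n) (T : set 'rV[R]_n)
  (x : 'rV[R]_n) (alpha : R -> 'rV[R]_m) : \bar R :=
  ereal_inf [set t%:E | t in [set t | 0 <= t /\ T (trajectory f x alpha t)]].

Definition admissible (R : realType) (n m : nat) (A : set 'rV[R]_m)
  (f : 'rV[R]_n -> 'rV[R]_m -> 'rV[R]_n) (T : set 'rV[R]_n)
  (x : 'rV[R]_n) : set (R -> 'rV[R]_m) :=
  [set alpha | is_control A alpha /\
     limf_einf (fun t => dist T (trajectory f x alpha t))
       (left_nbhs (exit_time f T x alpha)) = 0%E].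

Definition cost (R : realType) (n m : nat)
  (f : 'rV[R]_n -> 'rV[R]_m -> 'rV[R]_n) (l : 'rV[R]_n -> 'rV[R]_m -> R)
  (T : set 'rV[R]_n) (x : 'rV[R]_n) (alpha : R -> 'rV[R]_m) : \bar R :=
  (\int[lebesgue_measure]_(t in
      [set t : R | (0 <= t)%R /\ (t%:E < exit_time f T x alpha)%E])
    (l (trajectory f x alpha t) (alpha t))%:E)%E.

Definition value (R : realType) (n m : nat) (A : set 'rV[R]_m)
  (f : 'rV[R]_n -> 'rV[R]_m -> 'rV[R]_n) (l : 'rV[R]_n -> 'rV[R]_m -> R)
  (T : set 'rV[R]_n) (x : 'rV[R]_n) : \bar R :=
  if `[< T x >] then 0%E
  else ereal_inf [set cost f l T x alpha | alpha in admissible A f T x].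

Definition Dom (R : realType) (n m : nat) (A : set 'rV[R]_m)
  (f : 'rV[R]_n -> 'rV[R]_m -> 'rV[R]_n) (l : 'rV[R]_n -> 'rV[R]_m -> R)
  (T : set 'rV[R]_n) : set 'rV[R]_n :=
  [set x | (~` interior T) x /\ (value A f l T x < +oo)%E].

(* U is of class C^1 in the (arbitrary) set S, with gradient G. At interior
   points of S the gradient is the usual one. Restrictions to S of functions
   that are C^1 in a neighbourhood of S qualify. *)
Definition C1_in (R : realType) (n : nat) (S : set 'rV[R]_n)
  (U : 'rV[R]_n -> R) (G : 'rV[R]_n -> 'rV[R]_n) : Prop :=
  {within S, continuous G} /\
  forall x, S x -> forall e : R, 0 < e -> \forall z \near within S (nbhs x),
    `|U z - U x - dotp (G x) (z - x)| <= e * enorm (z - x).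

Definition increasing_positive (R : realType) (c : R -> R) : Prop :=
  [/\ (forall r, 0 < r -> 0 < c r),
      {within (`]0, +oo[%classic : set R), continuous c} &
      (forall r s, 0 < r -> r <= s -> c r <= c s)].

Definition SC1 (R : realType) (n m : nat) (A : set 'rV[R]_m)
  (f : 'rV[R]_n -> 'rV[R]_m -> 'rV[R]_n) (T : set 'rV[R]_n) : Prop :=
  exists (U : 'rV[R]_n -> R) (gradU : 'rV[R]_n -> 'rV[R]_n) (c : R -> R),
  [/\ (forall x, (~` interior T) x -> 0 <= U x),
      C1_in (~` interior T) U gradU,
      (forall x, (~` T) x -> 0 < U x) /\ (forall x, boundary T x -> U x = 0),
      (forall K : set R, compact K -> K `<=` [set r | 0 <= r] ->
         compact ((~` interior T) `&` U @^-1` K)) &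
      increasing_positive c /\
      (forall x, (~` T) x ->
         (ereal_sup [set (dotp (gradU x) (f x a))%:E | a in A]
            <= (- c (fine (dist T x)))%:E)%E)].

Definition SC2 (R : realType) (n m : nat) (A : set 'rV[R]_m)
  (l : 'rV[R]_n -> 'rV[R]_m -> R) (T : set 'rV[R]_n) : Prop :=
  exists c : R -> R, increasing_positive c /\
    (forall x a, (~` T) x -> A a -> c (fine (dist T x)) <= l x a).

(* Main.v *)
(* Everything follows from one local estimate around a point x outside the
   target: for every bound C and every e > 0, all z1, z2 close to x with
   V(z1) <= C satisfy V(z2) <= V(z1) + e. To prove it, take a nearly optimal
   control for z1. Either (SC1), through the decrease of the Lyapunov function
   along trajectories, or (SC2), through the running cost, bounds the time at
   which the trajectory from z1 gets within a prescribed distance of the target,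
   uniformly in z1. Up to that time, Gronwall's inequality keeps the trajectory
   from z2 under the same control close to that from z1, with a close cost.
   Either it hits the target, and the control is admissible for z2, or it ends
   near the target, where continuity of V on the compact boundary makes V
   uniformly small, so that one can switch to a control of small remaining
   cost. *)

Require Import Defs.
From mathcomp Require Import all_boot all_order all_algebra.
From mathcomp Require Import all_classical all_reals all_analysis.
From mathcomp Require Import measurable_realfun ring lra.
Import Order.TTheory GRing.Theory Num.Theory.
Import numFieldNormedType.Exports.
Local Open Scope classical_set_scope.
Local Open Scope ring_scope.
Set Implicit Arguments.
Unset Strict Implicit.
Unset Printing Implicit Defensive.

(** * Row vectors and measurability *)

(** The obstacle is that neither the exit time nor the set of admissible controls varies
    continuously with the initial point: a control that brings [z1] to the target may let the
    trajectory from [z2] miss it, and admissibility also allows an infinite exit time, with the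
    distance to the target small only along some sequence of times. The comparison therefore stops
    strictly before the exit, when the first trajectory is within [d / 2] of the target. The bound
    [b] on that time has to be fixed before the neighbourhood of [x] is chosen, because the Gronwall
    factor grows exponentially with [b]. Since [trajectory] is picked by a choice operator, nothing
    is known about it until existence and uniqueness are proved for measurable controls. Uniqueness
    is also what identifies the trajectory of a switched control with the two pieces glued
    together. *)

Section RowVectorNorms.
Context {R : realType} {n : nat}.
Implicit Types u v : 'rV[R]_n.

Lemma ler_mx_normP u (B : R) : 0 <= B -> (forall i, `|u 0 i| <= B) -> `|u| <= B.
Proof.
move=> B0 h; rewrite /Num.norm /= mx_normrE; apply/bigmax_leP; split => // -[i j] _ /=.
by rewrite ord1.
Qed.

Lemma ler_coord_mx_norm u i : `|u 0 i| <= `|u|.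
Proof.
rewrite {2}/Num.norm /= mx_normrE.
exact: (le_bigmax _ (fun ij : 'I_1 * 'I_n => `|u ij.1 ij.2|) (ord0, i)).
Qed.

Lemma enorm_ge0 u : 0 <= enorm u.
Proof. exact: sqrtr_ge0. Qed.

Lemma ler_norm_enorm u : `|u| <= enorm u.
Proof.
apply: ler_mx_normP; first exact: enorm_ge0.
move=> i; rewrite -sqrtr_sqr ler_wsqrtr// expr2.
by rewrite /dotp (bigD1 i)//= lerDl sumr_ge0// => j _; rewrite -expr2 sqr_ge0.
Qed.

(** The factor [n] replaces the sharp square root of [n]; only equivalence of the two norms matters
    below. *)
Lemma ler_enorm_norm u : enorm u <= n%:R * `|u|.
Proof.
rewrite -[leRHS]ger0_norm ?mulr_ge0// -sqrtr_sqr ler_wsqrtr//.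
apply: (@le_trans _ _ (\sum_(i < n) `|u| ^+ 2)).
  apply: ler_sum => i _; rewrite -expr2 -[leLHS]real_normK ?num_real//.
  by rewrite lerXn2r ?nnegrE// ler_coord_mx_norm.
rewrite sumr_const card_ord -[leLHS]mulr_natl exprMn ler_wpM2r ?sqr_ge0//.
by case: n => [|k]; rewrite expr2 ?mulr0// ler_peMl// ler1n.
Qed.

Lemma ler_norm_dotp u v : `|dotp u v| <= n%:R * (`|u| * `|v|).
Proof.
rewrite (le_trans (ler_norm_sum _ _ _))//.
rewrite mulr_natl -[X in _ <= _ *+ X]card_ord -sumr_const ler_sum// => i _.
by rewrite normrM ler_pM// ler_coord_mx_norm.
Qed.

Lemma dotpBl u v w : dotp (u - v) w = dotp u w - dotp v w.
Proof. by rewrite -sumrB; apply: eq_bigr => i _; rewrite !mxE mulrBl. Qed.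

End RowVectorNorms.

Section MeasurableComposition.
Context {R : realType} {n m : nat}.
Variables (D : set R) (mD : measurable D).
Variables (y : R -> 'rV[R]_n) (a : R -> 'rV[R]_m).
Hypothesis my : forall i, measurable_fun D (fun t => y t 0 i).
Hypothesis ma : forall i, measurable_fun D (fun t => a t 0 i).

Let box (q : 'rV[rat]_n * 'rV[rat]_m * nat) : set R :=
  D `&` [set t | (forall i, `|ratr (q.1.1 0 i) - y t 0 i| < q.2.+1%:R^-1) /\
                 (forall i, `|ratr (q.1.2 0 i) - a t 0 i| < q.2.+1%:R^-1)].

Let measurable_cube k (z : R -> 'rV[R]_k) (q : 'rV[rat]_k) (e : R) :
  (forall i, measurable_fun D (fun t => z t 0 i)) ->
  measurable (D `&` [set t | forall i, `|ratr (q 0 i) - z t 0 i| < e]).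
Proof.
move=> mz.
rewrite (_ : _ `&` _ = D `&` \bigcap_(i : 'I_k)
    (D `&` [set t | `|ratr (q 0 i) - z t 0 i| < e])); last first.
  apply/seteqP; split => t /= [Dt h]; split => //.
    by move=> i _; split => //; exact: h.
  by move=> i; have [] := h i I.
apply: measurableI => //.
apply: fin_bigcap_measurable => // i _.
have mf : measurable_fun D (fun t => `|ratr (q 0 i) - z t 0 i|).
  by apply: measurableT_comp => //; apply: measurable_funB => //; exact: mz.
have := mf mD _ (measurable_itv `]-oo, e[).
by congr measurable; apply/seteqP; split => t /=; rewrite in_itv.
Qed.

Let box_measurable q : measurable (box q).
Proof.
rewrite (_ : box q = (D `&` [set t | forall i,
      `|ratr (q.1.1 0 i) - y t 0 i| < q.2.+1%:R^-1]) `&`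
    (D `&` [set t | forall i, `|ratr (q.1.2 0 i) - a t 0 i| < q.2.+1%:R^-1])).
  by apply: measurableI; exact: measurable_cube.
by rewrite /box; apply/seteqP; split => t /= [] // => [Dt [h1 h2]|[Dt h1] [_ h2]].
Qed.

Let rat_approx k (x : 'rV[R]_k) (e : R) : 0 < e ->
  exists q : 'rV[rat]_k, forall i, `|ratr (q 0 i) - x 0 i| < e.
Proof.
move=> e0; have h i : exists q : rat, `|ratr q - x 0 i| < e.
  have /rat_in_itvoo[q] : x 0 i - e < x 0 i + e by rewrite ltrBlDr -addrA ltrDl addr_gt0.
  rewrite in_itv /= => /andP[h1 h2]; exists q.
  by rewrite ltr_distl h1 h2.
have [g hg] := choice h; exists (\row_i g i) => i; rewrite mxE; exact: hg.
Qed.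

(** Measurability is available coordinate by coordinate only, so [U] is written as the union of the
    countably many rational cubes it contains. Each point of [U] lies in such a cube: take the
    radius below half that of a ball inside [U], and a rational centre close to the point. *)
Lemma measurable_preimage_open_prod (U : set ('rV[R]_n * 'rV[R]_m)) : open U ->
  measurable (D `&` [set t | U (y t, a t)]).
Proof.
move=> oU.
pose Q := [set q : 'rV[rat]_n * 'rV[rat]_m * nat |
  forall (x : 'rV[R]_n) (b : 'rV[R]_m),
  (forall i, `|ratr (q.1.1 0 i) - x 0 i| < q.2.+1%:R^-1) ->
  (forall i, `|ratr (q.1.2 0 i) - b 0 i| < q.2.+1%:R^-1) -> U (x, b)].
rewrite (_ : _ `&` _ = \bigcup_q (if `[< Q q >] then box q else set0)).
  apply: countable_bigcupT_measurable; first exact: countableP.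
  by move=> q; case: ifPn => // _; exact: box_measurable.
apply/seteqP; split => t /=; last first.
  move=> [q _]; case: asboolP => // Qq [Dt [h1 h2]]; split => //.
  exact: Qq.
move=> [Dt Ut].
have /nbhs_ballP[e /= e0 he] : nbhs (y t, a t) U by exact: open_nbhs_nbhs.
have [k] := ltr_add_invr (divr_gt0 e0 (ltr0n R 2)); rewrite add0r => hk.
have k0 : 0 < (k.+1%:R : R)^-1 by rewrite invr_gt0.
have [q1 h1] := rat_approx (y t) k0.
have [q2 h2] := rat_approx (a t) k0.
have close (r u v : R) : `|r - u| < k.+1%:R^-1 -> `|r - v| < k.+1%:R^-1 -> `|u - v| < e.
  move=> hu hv; rewrite [e]splitr (_ : u - v = (r - v) - (r - u)); last by ring.
  by rewrite (le_lt_trans (ler_normB _ _))// ltrD// (lt_trans _ hk).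
exists (q1, q2, k) => //; case: asboolP => [_|[]]; first by split.
by move=> x b /= hx hb; apply: he; split; split => //= i j; rewrite ord1;
  apply: (close _ _ _ _ (hx _)) || apply: (close _ _ _ _ (hb _)).
Qed.

(** Continuity relative to [A] makes the preimage of an open ray the trace of an open set; the trace
    is harmless because [a] takes its values in [A]. *)
Lemma measurable_comp_within (A : set 'rV[R]_m) (h : 'rV[R]_n -> 'rV[R]_m -> R) :
  {within [set p : 'rV[R]_n * 'rV[R]_m | A p.2], continuous (fun p => h p.1 p.2)} ->
  (forall t, D t -> A (a t)) -> measurable_fun D (fun t => h (y t) (a t)).
Proof.
move=> hc Aa; apply: (measurability _ (RGenOInfty.measurableE R)).
move=> _ [_ [r ->] <-].
have /open_subspaceP[U oU UE] := (continuousP _).1 hc _ (rray_open r).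
rewrite (_ : _ `&` _ = D `&` [set t | U (y t, a t)]).
  exact: measurable_preimage_open_prod.
apply/seteqP; split => t /= [Dt]; rewrite in_itv /= andbT => H; split => //.
  have : (U `&` [set p | A p.2]) (y t, a t).
    by rewrite UE; split; [rewrite /= in_itv /= andbT|exact: Aa].
  by case.
have : ([set p | r < h p.1 p.2] `&` [set p | A p.2]) (y t, a t).
  have := UE; rewrite (_ : _ @^-1` _ = [set p | r < h p.1 p.2]); last first.
    by apply/seteqP; split => p /=; rewrite in_itv /= andbT.
  by move=> <-; split => //; exact: Aa.
by case.
Qed.

End MeasurableComposition.

(** * Translation invariance of the Lebesgue integral *)

Section LebesgueTranslation.
Context {R : realType}.
Notation mu := (@lebesgue_measure R).
Implicit Types (a : R) (D : set R).

Lemma measurable_addr a : measurable_fun [set: measurableTypeR R]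
  ((fun x : R => x + a) : measurableTypeR R -> measurableTypeR R).
Proof. exact: measurable_funD. Qed.

(** Lebesgue measure is determined by its values on half-open intervals, where translation is a
    direct computation. *)
Lemma pushforward_lebesgue_addr a D : measurable D ->
  pushforward mu (fun x : R => x + a) D = mu D.
Proof.
move=> mD; apply/esym.
pose nu : {measure set (measurableTypeR R) -> \bar R} :=
  measure_function_pushforward__canonical__measure_function_Measure
    mu (measurable_addr a).
apply: (lebesgue_measure_unique (mu := nu)) => //.
move=> X /ocitvP[->|[[b c] /= bc ->]]; first by rewrite !measure0.
rewrite /pushforward (_ : _ @^-1` _ = `]b - a, c - a]%classic); last first.
  by apply/seteqP; split => x /=; rewrite !in_itv /= ltrBlDr lerBrDr.
rewrite !lebesgue_measure_itv /= !lte_fin bc ltrD2r bc.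
by rewrite -!EFinB opprB addrA subrK.
Qed.

Lemma ge0_integral_shift a D (f : R -> \bar R) : measurable D ->
  measurable_fun D f -> (forall x, D x -> (0 <= f x)%E) ->
  (\int[mu]_(x in D) f x = \int[mu]_(x in [set x : R | D (x + a)%R]) f (x + a)%R)%E.
Proof.
move=> mD mf f0.
rewrite -[RHS](ge0_integral_pushforward (measurable_addr a) _ mD mf) //; last first.
  by move=> x; rewrite inE; exact: f0.
apply: eq_measure_integral; first exact: measurable_addr.
by move=> ma E mE _; apply/esym; exact: pushforward_lebesgue_addr.
Qed.

Lemma integral_shift a D (f : R -> \bar R) : measurable D -> measurable_fun D f ->
  (\int[mu]_(x in D) f x = \int[mu]_(x in [set x : R | D (x + a)%R]) f (x + a)%R)%E.
Proof.
move=> mD mf; rewrite integralE [RHS]integralE; congr (_ - _)%E.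
  rewrite (ge0_integral_shift a)//; last exact: measurable_funepos.
  by apply: eq_integral => x _; rewrite ?funeposE ?funenegE.
rewrite (ge0_integral_shift a)//; last exact: measurable_funeneg.
by apply: eq_integral => x _; rewrite ?funeposE ?funenegE.
Qed.

End LebesgueTranslation.

(** * Integral inequalities *)

Section IntervalIntegrals.
Context {R : realType}.
Notation mu := (@lebesgue_measure R).
Implicit Types (g : R -> R) (a b B c K s t : R).

Lemma bounded_integrable_itv g a b B : measurable_fun (`[a, b] : set R) g ->
  (forall s, a <= s <= b -> `|g s| <= B) ->
  mu.-integrable (`[a, b] : set R) (EFin \o g).
Proof.
move=> mg gB; apply: measurable_bounded_integrable => //.
  by rewrite /= lebesgue_measure_itv /=; case: ifPn => //; rewrite -EFinB ltry.
exists B; split; first exact: num_real.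
move=> x Bx z /=; rewrite in_itv /= => zab.
by rewrite (le_trans (gB _ zab))// ltW.
Qed.

Lemma Rintegral_cst_itv a b c : a <= b ->
  \int[mu]_(s in (`[a, b] : set R)) c = c * (b - a).
Proof.
rewrite le_eqVlt Rintegral_cst// /= lebesgue_measure_itv /= lte_fin.
by move=> /predU1P[->|->]; rewrite ?ltxx ?subrr//= -EFinB.
Qed.

Lemma ler_norm_Rintegral_itv g a b B : a <= b ->
  mu.-integrable (`[a, b] : set R) (EFin \o g) ->
  (forall s, a <= s <= b -> `|g s| <= B) ->
  `|\int[mu]_(s in (`[a, b] : set R)) g s| <= B * (b - a).
Proof.
move=> ab ig gB; rewrite (le_trans (le_normr_Rintegral _ ig))//.
rewrite -Rintegral_cst_itv//; apply: le_Rintegral => //.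
  exact: (integrable_norm ig).
exact: (@bounded_integrable_itv _ _ _ `|B|).
Qed.

Lemma Rintegral_itv_split g a b c : a <= b -> b <= c ->
  mu.-integrable (`[a, c] : set R) (EFin \o g) ->
  \int[mu]_(s in (`[a, c] : set R)) g s =
  \int[mu]_(s in (`[a, b] : set R)) g s + \int[mu]_(s in (`[b, c] : set R)) g s.
Proof.
move=> ab bc ig.
rewrite -(@Rintegral_itv_obnd_cbnd _ b (BRight c)).
  by rewrite -(Rintegral_itvB ig) ?bnd_simp// addrC subrK.
apply: integrableS ig => //; apply: subset_itvr; by rewrite bnd_simp.
Qed.

Lemma Rintegral_expR K c t : 0 < K -> 0 <= t ->
  mu.-integrable (`[0, t] : set R) (EFin \o (fun s => c * K * expR (2 * K * s))) /\
  \int[mu]_(s in (`[0, t] : set R)) (c * K * expR (2 * K * s)) =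
    c / 2 * (expR (2 * K * t) - 1).
Proof.
move=> K0 t0.
have cexp d : continuous (fun s : R => d * expR (2 * K * s)).
  move=> x; apply: cvgM; first exact: cvg_cst.
  apply: (continuous_comp (g := expR)); last exact: continuous_expR.
  by apply: cvgM; [exact: cvg_cst|exact: cvg_id].
split.
  apply: continuous_compact_integrable; first exact: segment_compact.
  exact: continuous_subspaceT.
move: t0; rewrite le_eqVlt => /predU1P[<-|t0].
  by rewrite mulr0 expR0 subrr mulr0 set_itv1 Rintegral_set1.
have dF (x : R) : is_derive x (1 : R) (fun s : R => c / 2 * expR (2 * K * s))
    (c * K * expR (2 * K * x)).
  by apply: is_derive_eq; rewrite /GRing.scale /=; field.
have H : (\int[mu]_(s in (`[0%R, t]%classic : set R)) (c * K * expR (2 * K * s))%R%:E =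
    (c / 2 * expR (2 * K * t))%R%:E - (c / 2 * expR (2 * K * 0))%R%:E)%E.
  apply: (continuous_FTC2 t0 (F := fun s : R => c / 2 * expR (2 * K * s))).
  - exact: continuous_subspaceT.
  - split; first by move=> z _; apply: ex_derive.
    + exact: (cvg_at_right_filter (cexp _ _)).
    + exact: (cvg_at_left_filter (cexp _ _)).
  - by move=> z _; rewrite derive1E; have [_ ->] := dF z.
by rewrite /Rintegral H /= mulr0 expR0 mulr1 mulrBr mulr1.
Qed.

(** The exponent [2 * K] is twice the Lipschitz rate, so integration halves the constant [c]. This
    factor 1/2 is the contraction behind both Gronwall's inequality and the Picard iteration. *)
Lemma ler_norm_Rintegral_expR g K c t : 0 < K -> 0 <= t -> 0 <= c ->
  mu.-integrable (`[0, t] : set R) (EFin \o g) ->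
  (forall s, 0 <= s <= t -> `|g s| <= K * (c * expR (2 * K * s))) ->
  `|\int[mu]_(s in (`[0, t] : set R)) g s| <= c / 2 * expR (2 * K * t).
Proof.
move=> K0 t0 c0 ig gB; have [ie eE] := Rintegral_expR c K0 t0.
rewrite (le_trans (le_normr_Rintegral _ ig))//.
rewrite (@le_trans _ _ (c / 2 * (expR (2 * K * t) - 1)))//; last first.
  by rewrite ler_wpM2l ?divr_ge0// lerBlDr lerDl.
rewrite -eE; apply: le_Rintegral => //; first exact: (integrable_norm ig).
by move=> s /=; rewrite in_itv /= => /gB; rewrite mulrA [K * c]mulrC.
Qed.

(* The weight [expR (-2 K t)] turns the integral inequality
   [u t <= u0 + K * int_0^t u] into a contraction, so the maximum of the
   weighted function bounds itself. *)
Lemma gronwall (u : R -> R) K u0 b : 0 < K -> 0 <= b -> 0 <= u0 ->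
  {within `[0, b], continuous u} -> (forall t, 0 <= t <= b -> 0 <= u t) ->
  (forall t c, 0 <= t <= b -> 0 <= c ->
     (forall s, 0 <= s <= t -> u s <= c * expR (2 * K * s)) ->
     u t <= u0 + c / 2 * expR (2 * K * t)) ->
  forall t, 0 <= t <= b -> u t <= 2 * u0 * expR (2 * K * t).
Proof.
move=> K0 b0 u00 cu upos hu.
pose w s := u s * expR (- (2 * K * s)).
have cE : continuous (fun s : R => expR (- (2 * K * s))).
  move=> x; apply: (@continuous_comp _ _ _ (fun s : R => - (2 * K * s)) expR);
    last exact: continuous_expR.
  by apply: cvgN; apply: cvgM; [exact: cvg_cst|exact: cvg_id].
have cw : {within `[0, b], continuous w}.
  by move=> x; apply: cvgM; [exact: cu|exact: (continuous_subspaceT cE)].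
have [tm] := EVT_max b0 cw; rewrite in_itv /= => tmb hmax.
have uw s : u s = w s * expR (2 * K * s).
  by rewrite /w -mulrA -expRD addNr expR0 mulr1.
have wm0 : 0 <= w tm by rewrite mulr_ge0 ?expR_ge0 ?upos.
have wm : w tm <= 2 * u0.
  have := hu tm (w tm) tmb wm0; rewrite [u tm]uw => H.
  have {}H : w tm * expR (2 * K * tm) <= u0 + w tm / 2 * expR (2 * K * tm).
    apply: H => s /andP[s0 st]; rewrite uw ler_wpM2r ?expR_ge0// hmax// in_itv /= s0.
    by case/andP: tmb => _; exact: le_trans.
  have e1 : 1 <= expR (2 * K * tm).
    by rewrite -expR0 ler_expR; case/andP: tmb => ? ?; rewrite !mulr_ge0// ltW.
  nra.
move=> t tb; rewrite uw ler_wpM2r ?expR_ge0//.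
by rewrite (le_trans (hmax _ _))// in_itv.
Qed.

End IntervalIntegrals.

Section GeometricCauchy.
Context {R : realType}.

Lemma ler_geometricP (a b C : R) : 0 <= C -> (forall k, a <= b + C / 2 ^+ k) -> a <= b.
Proof.
move=> C0 h; apply/ler_addgt0Pr => e e0.
have [k hk] := ltr_add_invr (divr_gt0 e0 (ltr_wpDl C0 ltr01)).
rewrite add0r in hk; rewrite (le_trans (h k))// lerD2l.
have C1 : 0 < C + 1 by rewrite ltr_wpDl.
have k1 : (k.+1%:R : R) <= 2 ^+ k by rewrite -natrX ler_nat ltn_expl.
rewrite (@le_trans _ _ ((C + 1) * k.+1%:R^-1))//.
  by rewrite ler_pM ?invr_ge0 ?exprn_ge0 ?lerDl// lef_pV2 ?posrE ?exprn_gt0.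
by rewrite ltW// mulrC -ltr_pdivlMr.
Qed.

(** The radius [2 * C / 2 ^+ k] is the tail of the geometric series, so the intervals of that radius
    about [u k] are nested; the limit is the supremum of their left ends. *)
Lemma geometric_cauchy_lim (u : nat -> R) (C : R) : 0 <= C ->
  (forall k, `|u k.+1 - u k| <= C / 2 ^+ k) ->
  exists l, forall k, `|u k - l| <= 2 * C / 2 ^+ k.
Proof.
move=> C0 hu; pose e k : R := 2 * C / 2 ^+ k.
have e0 k : 0 <= e k by rewrite /e divr_ge0 ?exprn_ge0 ?mulr_ge0.
have es k : e k = C / 2 ^+ k + e k.+1.
  by rewrite /e exprS; field; rewrite expf_neq0.
have step k : u k - e k <= u k.+1 - e k.+1 /\ u k.+1 + e k.+1 <= u k + e k.
  by have := hu k; rewrite (es k) ler_distl => /andP[]; split; lra.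
have mono j k : (j <= k)%N -> u j - e j <= u k - e k /\ u k + e k <= u j + e j.
  elim: k => [|k IH]; first by rewrite leqn0 => /eqP ->.
  rewrite leq_eqVlt => /predU1P[->//|]; rewrite ltnS => /IH[h1 h2].
  by have [h3 h4] := step k; split; [apply: le_trans h3|apply: le_trans h2].
have cross j k : u j - e j <= u k + e k.
  have [h1 _] := mono _ _ (leq_maxl j k); have [_ h2] := mono _ _ (leq_maxr j k).
  by have := e0 (maxn j k); lra.
pose S := range (fun k => u k - e k).
have S0 : S !=set0 by exists (u 0%N - e 0%N), 0%N.
exists (sup S) => k; rewrite ler_distl; apply/andP; split.
  by rewrite lerBlDr; apply: ge_sup => // _ [j _ <-]; exact: cross.
rewrite -lerBlDr; apply: ub_le_sup; last by exists k.
by exists (u k + e k) => _ [j _ <-]; exact: cross.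
Qed.

(* The limit is chosen before the rate [C]: the Picard iterates converge at a
   different rate on each [0, b], but to a single function. *)
Lemma geometric_cauchy_common_lim (u : nat -> R) :
  exists l, forall C : R, 0 <= C -> (forall k, `|u k.+1 - u k| <= C / 2 ^+ k) ->
  forall k, `|u k - l| <= 2 * C / 2 ^+ k.
Proof.
have [[C0 [C00 hC0]]|noC] := pselect (exists C : R, 0 <= C /\
    forall k, `|u k.+1 - u k| <= C / 2 ^+ k); last first.
  by exists 0 => C C0 hC; case: noC; exists C.
have [l hl] := geometric_cauchy_lim C00 hC0.
exists l => C C1 hC; have [l' hl'] := geometric_cauchy_lim C1 hC.
suff -> : l = l' by [].
apply/eqP; rewrite -subr_eq0 -normr_le0.
apply: (@ler_geometricP _ _ (2 * (C0 + C))); first by rewrite mulr_ge0// addr_ge0.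
move=> k; rewrite add0r mulrDr mulrDl (_ : l - l' = (u k - l') - (u k - l)); last by ring.
by rewrite (le_trans (ler_normB _ _))// addrC lerD.
Qed.

End GeometricCauchy.

(** * Caratheodory solutions *)

Section ControlledODE.
Context {R : realType} {n m : nat}.
Variables (A : set 'rV[R]_m) (f : 'rV[R]_n -> 'rV[R]_m -> 'rV[R]_n).
Notation mu := (@lebesgue_measure R).
Notation halfline := (`[0, +oo[%classic : set R).
Hypothesis f_cont : {within [set p : 'rV[R]_n * 'rV[R]_m | A p.2],
  continuous (fun p => f p.1 p.2)}.
Variable M : R.
Hypothesis M_gt0 : 0 < M.
Hypothesis f_growth : forall x a, A a -> `|f x a| <= M * (1 + `|x|).
Hypothesis f_lip : forall r : R, 0 < r -> exists2 L : R, 0 < L &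
  forall x1 x2 a, `|x1| <= r -> `|x2| <= r -> A a ->
    `|f x1 a - f x2 a| <= L * `|x1 - x2|.

Implicit Types (x : 'rV[R]_n) (y : R -> 'rV[R]_n) (alpha : R -> 'rV[R]_m) (t b : R).

Lemma measurable_coord y i : {within halfline, continuous y} ->
  measurable_fun halfline (fun t => y t 0 i).
Proof.
move=> cy; apply: subspace_continuous_measurable_fun => // t.
exact: (@continuous_comp (subspace halfline) _ _ y (fun v : 'rV[R]_n => v 0 i) t
  (cy t) (@coord_continuous _ _ _ _ _ _)).
Qed.

Lemma measurable_dynamics y alpha i : is_control A alpha ->
  (forall j, measurable_fun halfline (fun t => y t 0 j)) ->
  measurable_fun halfline (fun t => f (y t) (alpha t) 0 i).
Proof.
move=> [Aalpha malpha] my.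
apply: (measurable_comp_within _ my malpha (h := fun x a => f x a 0 i) (A := A)) => //.
  move=> p; exact: (@continuous_comp
    (subspace [set p : 'rV[R]_n * 'rV[R]_m | A p.2]) _ _ (fun p => f p.1 p.2)
    (fun v : 'rV[R]_n => v 0 i) p (@f_cont p) (@coord_continuous _ _ _ _ _ _)).
by move=> t /=; rewrite in_itv /= andbT; exact: Aalpha.
Qed.

Lemma measurable_fun_segment (g : R -> R) b : measurable_fun halfline g ->
  forall a, 0 <= a -> measurable_fun (`[a, b] : set R) g.
Proof.
move=> mg a a0; apply: measurable_funS mg => //.
by move=> t /=; rewrite !in_itv /= andbT => /andP[+ _]; exact: le_trans.
Qed.

Lemma dynamics_integrable y alpha i b B : is_control A alpha ->
  (forall j, measurable_fun halfline (fun t => y t 0 j)) ->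
  (forall t, 0 <= t <= b -> `|y t| <= B) ->
  mu.-integrable (`[0, b] : set R) (EFin \o (fun t => f (y t) (alpha t) 0 i)).
Proof.
move=> ha my yB; apply: (@bounded_integrable_itv _ _ _ _ (M * (1 + B))).
  exact: measurable_fun_segment (measurable_dynamics _ ha my) _ _.
move=> t tb; rewrite (le_trans (ler_coord_mx_norm _ _))//.
case/andP: (tb) => t0 _; rewrite (le_trans (f_growth _ (ha.1 _ t0)))//.
by rewrite ler_pM2l// lerD2l yB.
Qed.

(** Adding 1 to the norm turns the affine growth of [f] into a homogeneous integral inequality, to
    which Gronwall applies. *)
Lemma solution_bound x alpha y : is_control A alpha -> is_solution f x alpha y ->
  forall t, 0 <= t -> 1 + `|y t| <= 2 * (1 + `|x|) * expR (2 * M * t).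
Proof.
move=> ha [cy hy] t t0.
apply: (@gronwall _ (fun t => 1 + `|y t|) M (1 + `|x|) t) => //; last by rewrite t0 lexx.
  have cy' : {within `[0, t], continuous y}.
    apply: continuous_subspaceW cy => s /=.
    by rewrite !in_itv /= andbT => /andP[].
  move=> s; apply: cvgD; first exact: cvg_cst.
  exact: cvg_norm (cy' s).
move=> s c /andP[s0 st] c0 hs; rewrite -addrA lerD2l.
apply: ler_mx_normP; first by rewrite addr_ge0// mulr_ge0 ?expR_ge0 ?divr_ge0.
move=> i; have [ii ->] := hy s s0 i.
rewrite (le_trans (ler_normD _ _))// lerD// ?ler_coord_mx_norm//.
apply: ler_norm_Rintegral_expR => // r /andP[r0 rs].
rewrite (le_trans (ler_coord_mx_norm _ _))//.
by rewrite (le_trans (f_growth _ (ha.1 _ r0)))// ler_pM2l// hs// r0.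
Qed.

Lemma solution_dependence x1 x2 alpha y1 y2 b r L : is_control A alpha ->
  is_solution f x1 alpha y1 -> is_solution f x2 alpha y2 -> 0 < L ->
  (forall x1 x2 a, `|x1| <= r -> `|x2| <= r -> A a ->
    `|f x1 a - f x2 a| <= L * `|x1 - x2|) ->
  (forall t, 0 <= t <= b -> `|y1 t| <= r /\ `|y2 t| <= r) ->
  forall t, 0 <= t <= b -> `|y1 t - y2 t| <= 2 * `|x1 - x2| * expR (2 * L * t).
Proof.
move=> ha [cy1 hy1] [cy2 hy2] L0 fL yr t tb.
have b0 : 0 <= b by case/andP: tb; exact: le_trans.
apply: (@gronwall _ (fun t => `|y1 t - y2 t|) L `|x1 - x2| b) => //.
- have sub : `[0, b] `<=` halfline.
    by move=> s /=; rewrite !in_itv /= andbT => /andP[].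
  move=> s; apply: (@cvg_norm _ _ _ _ _ _ (y1 s - y2 s)).
  apply: cvgB; [exact: (continuous_subspaceW sub cy1)|exact: (continuous_subspaceW sub cy2)].
move=> {tb}s c /andP[s0 sb] c0 hs.
apply: ler_mx_normP; first by rewrite addr_ge0// mulr_ge0 ?expR_ge0 ?divr_ge0.
move=> i; have [i1 e1] := hy1 s s0 i; have [i2 e2] := hy2 s s0 i.
rewrite !mxE e1 e2 (_ : _ - _ = (x1 - x2) 0 i +
   \int[mu]_(r in (`[0, s] : set R)) (f (y1 r) (alpha r) 0 i - f (y2 r) (alpha r) 0 i)).
  rewrite (le_trans (ler_normD _ _))// lerD// ?ler_coord_mx_norm//.
  apply: ler_norm_Rintegral_expR => //.
    have := integrableB _ i1 i2; rewrite /=; apply; exact: measurable_itv.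
  move=> q /andP[q0 qs].
  have [h1 h2] : `|y1 q| <= r /\ `|y2 q| <= r by apply: yr; rewrite q0 (le_trans qs).
  have := ler_coord_mx_norm (f (y1 q) (alpha q) - f (y2 q) (alpha q)) i.
  rewrite !mxE => /le_trans; apply.
  rewrite (le_trans (fL _ _ _ h1 h2 (ha.1 _ q0)))// ler_pM2l//.
  by rewrite hs// q0.
by rewrite RintegralB// !mxE; ring.
Qed.

Lemma solution_unique x alpha y1 y2 : is_control A alpha ->
  is_solution f x alpha y1 -> is_solution f x alpha y2 ->
  forall t, 0 <= t -> y1 t = y2 t.
Proof.
move=> ha s1 s2 t t0; pose r := 2 * (1 + `|x|) * expR (2 * M * t).
have r0 : 0 < r by rewrite !mulr_gt0 ?expR_gt0// ltr_pwDl.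
have [L L0 fL] := f_lip r0.
have bnd y s : is_solution f x alpha y -> 0 <= s <= t -> `|y s| <= r.
  move=> hy /andP[s0 st]; rewrite (@le_trans _ _ (1 + `|y s|)) ?lerDr//.
  rewrite (le_trans (solution_bound ha hy s0))// ler_wpM2l ?mulr_ge0 ?addr_ge0//.
  by rewrite ler_expR ler_wpM2l// mulr_ge0// ltW.
have := @solution_dependence x x alpha y1 y2 t r L ha s1 s2 L0 fL.
move=> /(_ (fun s hs => conj (bnd _ s s1 hs) (bnd _ s s2 hs)) t).
rewrite t0 lexx subrr normr0 mulr0 mul0r normr_le0 subr_eq0 => /(_ isT).
by move/eqP.
Qed.

(** The common route to continuity for Picard iterates, their limit and concatenated solutions, all
    of which are Lipschitz on bounded intervals. *)
Lemma locally_lipschitz_continuous y :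
  (forall b, exists B, forall s t, 0 <= s -> s <= t -> t <= b ->
    `|y t - y s| <= B * (t - s)) ->
  {within halfline, continuous y}.
Proof.
move=> ylip; apply/subspace_continuousP => t /=; rewrite in_itv /= andbT => t0.
apply/cvgrPdist_lt => e e0; have [B hB] := ylip (t + 1).
have B1 : 0 < `|B| + 1 by rewrite ltr_wpDl.
have hB' p q : 0 <= p -> p <= q -> q <= t + 1 -> `|y q - y p| <= (`|B| + 1) * (q - p).
  move=> p0 pq qt; rewrite (le_trans (hB _ _ p0 pq qt))// ler_wpM2r ?subr_ge0//.
  by rewrite (le_trans (ler_norm B))// lerDl.
apply/nbhs_ballP; exists (Num.min 1 (e / (`|B| + 1))) => /=.
  by rewrite lt_min ltr01 divr_gt0.
move=> s; rewrite /ball /= lt_min ltr_pdivlMr// => /andP[s1 s2].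
rewrite in_itv /= andbT => s0; move: s1; rewrite ltr_distl => /andP[st1 st2].
have [st|/ltW ts] := leP s t.
  rewrite (le_lt_trans (hB' _ _ s0 st _)) ?lerDl// mulrC (le_lt_trans _ s2)//.
  by rewrite ler_wpM2r ?ler_norm// ltW.
rewrite distrC (le_lt_trans (hB' _ _ t0 ts _))//; first by lra.
rewrite mulrC (le_lt_trans _ s2)// distrC.
by rewrite ler_wpM2r ?ler_norm// ltW.
Qed.

(* All iterates obey the a priori bound [growth] of a solution, so on each
   [0, b] one Lipschitz constant serves them all and [f] need not be truncated. *)
Section PicardIteration.
Variables (x0 : 'rV[R]_n) (alpha : R -> 'rV[R]_m).
Hypothesis alpha_control : is_control A alpha.

Let picard_step y : R -> 'rV[R]_n := fun t =>
  \row_i (x0 0 i + \int[mu]_(s in (`[0, t] : set R)) f (y s) (alpha s) 0 i).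

Let growth t := 2 * (1 + `|x0|) * expR (2 * M * t).

Let growth_ge0 t : 0 <= growth t.
Proof. by rewrite /growth mulr_ge0 ?expR_ge0// mulr_ge0// addr_ge0. Qed.

Let growth_le s t : s <= t -> growth s <= growth t.
Proof.
move=> st; rewrite /growth ler_wpM2l ?mulr_ge0 ?addr_ge0//.
by rewrite ler_expR ler_wpM2l// mulr_ge0// ltW.
Qed.

Let good y := (forall j, measurable_fun halfline (fun t => y t 0 j)) /\
  (forall t, 0 <= t -> 1 + `|y t| <= growth t).

Let good_bound y b : good y -> forall t, 0 <= t <= b -> `|y t| <= growth b.
Proof.
move=> [_ yb] t /andP[t0 tb]; rewrite (@le_trans _ _ (1 + `|y t|)) ?lerDr//.
by rewrite (le_trans (yb _ t0))// growth_le.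
Qed.

Let good_integrable y b i : good y ->
  mu.-integrable (`[0, b] : set R) (EFin \o (fun t => f (y t) (alpha t) 0 i)).
Proof.
by move=> gy; apply: (dynamics_integrable _ alpha_control gy.1 (good_bound gy)).
Qed.

Let picard_step_lipschitz y b s t : good y -> 0 <= s -> s <= t -> t <= b ->
  `|picard_step y t - picard_step y s| <= M * (1 + growth b) * (t - s).
Proof.
move=> gy s0 st tb; apply: ler_mx_normP.
  by rewrite mulr_ge0 ?subr_ge0// mulr_ge0 ?(ltW M_gt0)// addr_ge0.
move=> i; rewrite !mxE (Rintegral_itv_split s0 st (good_integrable t i gy)).
rewrite (_ : _ - _ = \int[mu]_(r in (`[s, t] : set R)) f (y r) (alpha r) 0 i);
  last by ring.
apply: ler_norm_Rintegral_itv => //.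
  apply: integrableS (good_integrable t i gy) => // r /=.
  by rewrite !in_itv /= => /andP[sr ->]; rewrite (le_trans s0).
move=> r /andP[sr rt]; have r0 := le_trans s0 sr.
rewrite (le_trans (ler_coord_mx_norm _ _))//.
rewrite (le_trans (f_growth _ (alpha_control.1 _ r0)))// ler_pM2l// lerD2l.
by apply: good_bound => //; rewrite r0 (le_trans rt).
Qed.

(** The factor 2 in [growth] leaves one half for the initial term [1 + |x0|], since the exponential
    is at least 1, and the other half for the integral. *)
Let good_picard_step y : good y -> good (picard_step y).
Proof.
move=> gy; split.
  move=> j; apply: measurable_coord; apply: locally_lipschitz_continuous => b.
  by exists (M * (1 + growth b)) => s t; exact: picard_step_lipschitz.
move=> t t0; have [e0 x00] : 1 <= expR (2 * M * t) /\ 0 <= `|x0|.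
  by split=> //; rewrite -expR0 ler_expR !mulr_ge0// ltW.
have : `|picard_step y t| <= `|x0| + 2 * (1 + `|x0|) / 2 * expR (2 * M * t).
  apply: ler_mx_normP.
    by rewrite addr_ge0// mulr_ge0 ?expR_ge0// divr_ge0// mulr_ge0// addr_ge0.
  move=> i; rewrite mxE (le_trans (ler_normD _ _))// lerD// ?ler_coord_mx_norm//.
  apply: ler_norm_Rintegral_expR => //.
    exact: good_integrable.
  move=> s /andP[s0 st]; rewrite (le_trans (ler_coord_mx_norm _ _))//.
  rewrite (le_trans (f_growth _ (alpha_control.1 _ s0)))// ler_pM2l//.
  exact: gy.2.
by rewrite /growth; nra.
Qed.

Let picard k := iter k picard_step (fun=> x0).

Let good_picard k : good (picard k).
Proof.
elim: k => [|k IH]; last exact: good_picard_step.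
split=> [j|t t0 /=]; first exact: measurable_cst.
have [e0 x00] : 1 <= expR (2 * M * t) /\ 0 <= `|x0|.
  by split=> //; rewrite -expR0 ler_expR !mulr_ge0// ltW.
by rewrite /growth; nra.
Qed.

Let picard_step_contraction y z b L c t : good y -> good z -> 0 < L -> 0 <= c ->
  (forall x1 x2 a, `|x1| <= growth b -> `|x2| <= growth b -> A a ->
    `|f x1 a - f x2 a| <= L * `|x1 - x2|) ->
  0 <= t <= b ->
  (forall s, 0 <= s <= t -> `|y s - z s| <= c * expR (2 * L * s)) ->
  `|picard_step y t - picard_step z t| <= c / 2 * expR (2 * L * t).
Proof.
move=> gy gz L0 c0 fL /andP[t0 tb] yz.
apply: ler_mx_normP; first by rewrite mulr_ge0 ?expR_ge0// divr_ge0.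
move=> i; rewrite !mxE opprD addrACA subrr add0r -RintegralB//;
  try exact: good_integrable.
apply: ler_norm_Rintegral_expR => //.
  have := integrableB _ (good_integrable t i gy) (good_integrable t i gz).
  by rewrite /=; apply; exact: measurable_itv.
move=> s /andP[s0 st]; have sb : 0 <= s <= b by rewrite s0 (le_trans st).
have := ler_coord_mx_norm (f (y s) (alpha s) - f (z s) (alpha s)) i.
rewrite !mxE => /le_trans; apply.
rewrite (le_trans (fL _ _ _ (good_bound gy sb) (good_bound gz sb) (alpha_control.1 _ s0)))//.
by rewrite ler_pM2l// yz// s0.
Qed.

Let picard_cauchy b : exists2 C, 0 <= C & forall k t, 0 <= t <= b ->
  `|picard k.+1 t - picard k t| <= C / 2 ^+ k.
Proof.
have [|L L0 fL] := @f_lip (growth b + 1); first by rewrite ltr_wpDl.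
(* [2 * growth b] bounds the first increment by the triangle inequality, and the exponential is the
   largest weight on [0, b]. *)
exists (2 * growth b * expR (2 * L * b)); first by rewrite mulr_ge0 ?expR_ge0 ?mulr_ge0.
move=> k t tb.
have key s : 0 <= s <= b ->
    `|picard k.+1 s - picard k s| <= 2 * growth b / 2 ^+ k * expR (2 * L * s).
  elim: k s => [|k IH] s sb.
    rewrite expr0 divr1 (le_trans (ler_normB _ _))//.
    have h1 := good_bound (good_picard 1) sb; have h0 := good_bound (good_picard 0) sb.
    have e1 : 1 <= expR (2 * L * s).
      have s0 : 0 <= s by case/andP: sb.
      by rewrite -expR0 ler_expR !mulr_ge0// ltW.
    by have := growth_ge0 b; move: h1 h0; nra.
  have c0 : 0 <= 2 * growth b / 2 ^+ k by rewrite divr_ge0 ?exprn_ge0 ?mulr_ge0.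
  rewrite (_ : 2 * growth b / 2 ^+ k.+1 = 2 * growth b / 2 ^+ k / 2); last first.
    by rewrite exprS; field; rewrite expf_neq0.
  apply: (picard_step_contraction (good_picard k.+1) (good_picard k) L0 c0 (b := b)) => //.
    move=> x1 x2 a h1 h2; apply: fL; first by rewrite (le_trans h1)// lerDl.
    by rewrite (le_trans h2)// lerDl.
  move=> r /andP[r0 rs]; apply: IH; rewrite r0 (le_trans rs)//.
  by case/andP: sb.
rewrite (le_trans (key t tb))// mulrAC ler_wpM2r ?invr_ge0 ?exprn_ge0//.
rewrite ler_wpM2l ?mulr_ge0// ler_expR ler_wpM2l//; last by case/andP: tb.
by rewrite mulr_ge0// ltW.
Qed.

Lemma solution_exists : exists y, is_solution f x0 alpha y.
Proof.
(* The limit is chosen at each time and coordinate, independently of any horizon [b], so that [y] is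
   one function on the whole half-line. *)
have [l hl] := choice (fun ti : R * 'I_n =>
  geometric_cauchy_common_lim (fun k => picard k ti.1 0 ti.2)).
pose y t : 'rV[R]_n := \row_i l (t, i).
have approx b C : 0 <= C -> (forall k t, 0 <= t <= b ->
      `|picard k.+1 t - picard k t| <= C / 2 ^+ k) ->
    forall k t, 0 <= t <= b -> `|picard k t - y t| <= 2 * C / 2 ^+ k.
  move=> C0 hC k t tb; apply: ler_mx_normP.
    by rewrite divr_ge0 ?exprn_ge0 ?mulr_ge0.
  move=> i; rewrite !mxE; apply: (hl (t, i)) => // j /=.
  by have := le_trans (ler_coord_mx_norm _ i) (hC j t tb); rewrite !mxE.
have y_growth t : 0 <= t -> 1 + `|y t| <= growth t.
  move=> t0; have [C C0 hC] := picard_cauchy t.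
  apply: (@ler_geometricP _ _ _ (2 * C)) => [|k]; first by rewrite mulr_ge0.
  rewrite (@le_trans _ _ (1 + `|picard k t| + `|picard k t - y t|))//.
    rewrite -addrA lerD2l; have := ler_normB (picard k t) (picard k t - y t).
    by rewrite subKr.
  by rewrite lerD ?(good_picard k).2// (approx t)// t0 lexx.
have y_lip b s t : 0 <= s -> s <= t -> t <= b ->
    `|y t - y s| <= M * (1 + growth b) * (t - s).
  move=> s0 st tb; have [C C0 hC] := picard_cauchy b.
  apply: (@ler_geometricP _ _ _ (2 * C)) => [|k]; first by rewrite mulr_ge0.
  have sb : 0 <= s <= b by rewrite s0 (le_trans st).
  have tb' : 0 <= t <= b by rewrite tb (le_trans s0).
  have := approx b C C0 hC k.+1 t tb'; have := approx b C C0 hC k.+1 s sb.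
  have := picard_step_lipschitz (good_picard k) s0 st tb.
  rewrite -/(picard k.+1 t).
  rewrite (_ : 2 * C / 2 ^+ k.+1 = C / 2 ^+ k); last first.
    by rewrite exprS; field; rewrite expf_neq0.
  rewrite -/(picard k.+1 s) (_ : y t - y s = (picard k.+1 t - picard k.+1 s) +
    (picard k.+1 s - y s) - (picard k.+1 t - y t)); last first.
    by rewrite addrA subrK opprB [RHS]addrC addrA subrK.
  move=> h1 h2 h3; rewrite (le_trans (ler_normB _ _))//.
  rewrite (_ : 2 * C / 2 ^+ k = C / 2 ^+ k + C / 2 ^+ k); last by ring.
  by rewrite [leRHS]addrA lerD// (le_trans (ler_normD _ _))// lerD.
have cy : {within halfline, continuous y}.
  by apply: locally_lipschitz_continuous => b; exists (M * (1 + growth b)); exact: y_lip.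
have gy : good y by split=> // j; exact: measurable_coord.
exists y; split=> // t t0 i; split; first exact: good_integrable.
suff -> : y t = picard_step y t by rewrite mxE.
(* Both sides are compared with [picard k.+1 t]: [y t] through the convergence rate,
   [picard_step y t] through the contraction. No limit has to be taken under the integral. *)
apply/eqP; rewrite -subr_eq0 -normr_le0.
have [C C0 hC] := picard_cauchy t.
have [|L L0 fL] := @f_lip (growth t + 1); first by rewrite ltr_wpDl.
have tt : 0 <= t <= t by rewrite t0 lexx.
apply: (@ler_geometricP _ _ _ (C * (1 + expR (2 * L * t)))) => [|k].
  by rewrite mulr_ge0// addr_ge0 ?expR_ge0.
have h1 := approx t C C0 hC k.+1 t tt.
have h2 : `|picard k.+1 t - picard_step y t| <= 2 * C / 2 ^+ k / 2 * expR (2 * L * t).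
  apply: (picard_step_contraction (good_picard k) gy L0 _ _ tt).
  - by rewrite divr_ge0 ?exprn_ge0 ?mulr_ge0.
  - move=> x1 x2 a hx1 hx2; apply: fL; first by rewrite (le_trans hx1)// lerDl.
    by rewrite (le_trans hx2)// lerDl.
  move=> s st; rewrite (le_trans (approx t C C0 hC k s st))//.
  rewrite ler_peMr ?divr_ge0 ?exprn_ge0 ?mulr_ge0//.
  have s0 : 0 <= s by case/andP: st.
  by rewrite -expR0 ler_expR !mulr_ge0// ltW.
rewrite add0r (_ : y t - _ = (picard k.+1 t - picard_step y t) - (picard k.+1 t - y t));
  last by rewrite opprB [RHS]addrC addrA subrK.
rewrite (le_trans (ler_normB _ _))// (le_trans (lerD h2 h1))//.
rewrite exprS le_eqVlt; apply/orP; left; apply/eqP; field.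
by rewrite expf_neq0.
Qed.

End PicardIteration.

End ControlledODE.

(** * Trajectories and switched solutions *)

Section ControlledTrajectories.
Context {R : realType} {n m : nat}.
Variables (A : set 'rV[R]_m) (f : 'rV[R]_n -> 'rV[R]_m -> 'rV[R]_n).
Notation mu := (@lebesgue_measure R).
Notation halfline := (`[0, +oo[%classic : set R).
Hypothesis f_cont : {within [set p : 'rV[R]_n * 'rV[R]_m | A p.2],
  continuous (fun p => f p.1 p.2)}.
Variable M : R.
Hypothesis M_gt0 : 0 < M.
Hypothesis f_growth : forall x a, A a -> `|f x a| <= M * (1 + `|x|).
Hypothesis f_lip : forall r : R, 0 < r -> exists2 L : R, 0 < L &
  forall x1 x2 a, `|x1| <= r -> `|x2| <= r -> A a ->
    `|f x1 a - f x2 a| <= L * `|x1 - x2|.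

Implicit Types (x : 'rV[R]_n) (y : R -> 'rV[R]_n) (alpha : R -> 'rV[R]_m) (t b : R).

(** Existence rules out the default value [fun=> x] of [xget]. *)
Lemma trajectoryP x alpha : is_control A alpha ->
  is_solution f x alpha (trajectory f x alpha).
Proof.
move=> ha; apply: (@xgetPex _ (fun=> x) (is_solution f x alpha)).
exact: (solution_exists f_cont M_gt0 f_growth f_lip x ha).
Qed.

Lemma trajectory_unique x alpha y t : is_control A alpha -> is_solution f x alpha y ->
  0 <= t -> trajectory f x alpha t = y t.
Proof.
move=> ha hy.
exact: (solution_unique M_gt0 f_growth f_lip ha (trajectoryP x ha) hy).
Qed.

Lemma solution0 x alpha y : is_solution f x alpha y -> y 0 = x.
Proof.
move=> [_ /(_ 0 (lexx _)) hy]; apply/rowP => i; have [_ ->] := hy i.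
by rewrite set_itv1 Rintegral_set1 addr0.
Qed.

Lemma solution_increment x alpha y s t i : is_solution f x alpha y ->
  0 <= s -> s <= t ->
  mu.-integrable (`[s, t] : set R) (EFin \o (fun r => f (y r) (alpha r) 0 i)) /\
  y t 0 i - y s 0 i = \int[mu]_(r in (`[s, t] : set R)) f (y r) (alpha r) 0 i.
Proof.
move=> [_ hy] s0 st; have [it et] := hy t (le_trans s0 st) i.
have [js es] := hy s s0 i; split.
  apply: integrableS it => // r /=.
  by rewrite !in_itv /= => /andP[sr ->]; rewrite (le_trans s0).
by rewrite et es (Rintegral_itv_split s0 st it); ring.
Qed.

Lemma solution_dynamics_bound x alpha y b : is_control A alpha -> is_solution f x alpha y ->
  exists2 B, 0 <= B & forall t, 0 <= t <= b -> `|f (y t) (alpha t)| <= B.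
Proof.
move=> ha hy; pose B := M * (2 * (1 + `|x|) * expR (2 * M * b)).
exists B; first by rewrite mulr_ge0 ?(ltW M_gt0)// mulr_ge0 ?expR_ge0// mulr_ge0// addr_ge0.
move=> t /andP[t0 tb]; rewrite (le_trans (f_growth _ (ha.1 _ t0)))//.
rewrite ler_pM2l// (le_trans (solution_bound M_gt0 f_growth ha hy t0))//.
by rewrite ler_wpM2l ?mulr_ge0 ?addr_ge0// ler_expR ler_wpM2l// mulr_ge0// ltW.
Qed.

Lemma solution_lipschitz x alpha y b : is_control A alpha -> is_solution f x alpha y ->
  exists2 B, 0 <= B & forall s t, 0 <= s -> s <= t -> t <= b ->
    `|y t - y s| <= B * (t - s).
Proof.
move=> ha hy; have [B B0 hB] := solution_dynamics_bound b ha hy.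
exists B => // s t s0 st tb; apply: ler_mx_normP.
  by rewrite mulr_ge0// subr_ge0.
move=> i; rewrite !mxE; have [ii ->] := solution_increment i hy s0 st.
apply: ler_norm_Rintegral_itv => // r /andP[sr rt].
by rewrite (le_trans (ler_coord_mx_norm _ _))// hB// (le_trans s0 sr) (le_trans rt).
Qed.

(** Generic in [X] because it glues controls, trajectories and real coordinates alike. The value at
    [tau] belongs to [v]. *)
Definition concat {X : Type} (tau : R) (u v : R -> X) (t : R) : X :=
  if t < tau then u t else v (t - tau).

Lemma measurable_concat tau (u v : R -> R) : 0 <= tau ->
  measurable_fun halfline u -> measurable_fun halfline v ->
  measurable_fun halfline (concat tau u v).
Proof.
move=> tau0 mu_ mv.
rewrite (_ : halfline = `[0, tau[ `|` `[tau, +oo[).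
  apply/measurable_funU => //; split.
    apply: (eq_measurable_fun u).
      by move=> t; rewrite inE /= in_itv /= /concat => /andP[_ ->].
    apply: measurable_funS mu_ => // t /=; rewrite !in_itv /= andbT.
    by move=> /andP[].
  apply: (eq_measurable_fun (v \o (fun t => t - tau))).
    by move=> t; rewrite inE /= in_itv /= andbT /concat ltNge => ->.
  apply: (measurable_comp (F := halfline)) => //.
    by move=> _ [t /= + <-]; rewrite !in_itv /= !andbT subr_ge0.
  exact: measurable_funB.
apply/seteqP; split => t /=; rewrite !in_itv /= !andbT.
  by move=> t0; have [|] := ltP t tau; [left|right]; rewrite ?t0.
by move=> [/andP[]//|]; exact: le_trans.
Qed.

Lemma concat_control tau alpha beta : 0 <= tau -> is_control A alpha ->
  is_control A beta -> is_control A (concat tau alpha beta).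
Proof.
move=> tau0 [Aa ma] [Ab mb]; split.
  move=> t t0; rewrite /concat; case: ltP => h; first exact: Aa.
  by apply: Ab; rewrite subr_ge0.
move=> i; rewrite (_ : (fun t => _) =
    concat tau (fun t => alpha t 0 i) (fun t => beta t 0 i)).
  exact: measurable_concat.
by apply/funext => t; rewrite /concat; case: ifP.
Qed.

Lemma concat_solution x alpha beta y v tau : 0 <= tau ->
  is_control A alpha -> is_control A beta ->
  is_solution f x alpha y -> is_solution f (y tau) beta v ->
  is_solution f x (concat tau alpha beta) (concat tau y v).
Proof.
move=> tau0 ha hb hy hv; set w := concat tau y v; set gamma := concat tau alpha beta.
have hg : is_control A gamma by exact: concat_control.
have wlip b : exists B, forall s t, 0 <= s -> s <= t -> t <= b ->
    `|w t - w s| <= B * (t - s).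
  have [B1 B10 h1] := solution_lipschitz (Num.max b tau) ha hy.
  have [B2 B20 h2] := solution_lipschitz b hb hv.
  exists (B1 + B2) => s t s0 st tb; rewrite /w /concat.
  have [ttau|taut] := ltP t tau.
    rewrite (le_lt_trans st ttau) (le_trans (h1 _ _ s0 st _)) ?le_max ?tb//.
    by rewrite ler_wpM2r ?subr_ge0 ?lerDl.
  have [stau|taus] := ltP s tau.
    have d1 := h1 _ _ s0 (ltW stau) _; have d2 := h2 0 (t - tau) (lexx _) _ _.
    (* Across the switching time the two Lipschitz bounds are joined at the common value
       [v 0 = y tau]. *)
    rewrite (_ : v _ - y s = (v (t - tau) - v 0) + (y tau - y s)); last first.
      by rewrite (solution0 hv) addrA subrK.
    rewrite (le_trans (ler_normD _ _))// (@le_trans _ _ (B2 * (t - tau - 0) + B1 * (tau - s)))//.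
      rewrite lerD// ?d1 ?d2 ?subr_ge0 ?le_max ?lexx ?orbT//.
      by rewrite lerBlDr (le_trans tb)// lerDl.
    nra.
  rewrite (_ : t - s = (t - tau) - (s - tau)); last by ring.
  rewrite (le_trans (h2 _ _ _ _ _)) ?subr_ge0 ?lerD2r//.
    by rewrite lerBlDr (le_trans tb)// lerDl.
  by rewrite ler_wpM2r ?lerDr// subr_ge0 lerD2r.
have cw : {within halfline, continuous w}.
  exact: locally_lipschitz_continuous wlip.
have w0 : w 0 = x.
  rewrite /w /concat; case: ltP => h; first exact: solution0 hy.
  have -> : tau = 0 by apply/eqP; rewrite eq_le h.
  by rewrite subrr (solution0 hv) (_ : tau = 0) ?(solution0 hy)//; apply/eqP; rewrite eq_le h.
split=> // t t0 i.
have iw : mu.-integrable (`[0, t] : set R) (EFin \o (fun s => f (w s) (gamma s) 0 i)).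
  have [B hB] := wlip t.
  apply: (@dynamics_integrable _ _ _ A f f_cont M M_gt0 f_growth w gamma i t
    (`|B| * t + `|x|)) => //.
    by move=> j; exact: measurable_coord.
  move=> s /andP[s0 st]; rewrite -[w s](subrK (w 0)) (le_trans (ler_normD _ _))//.
  rewrite w0 lerD// -{1}w0 (le_trans (hB _ _ (lexx _) s0 st))// subr0.
  by rewrite (le_trans (ler_norm _))// normrM ler_wpM2l// ger0_norm.
split=> //.
have [ttau|taut] := ltP t tau.
  rewrite {1}/w /concat ttau (hy.2 t t0 i).2; congr (_ + _).
  apply: eq_Rintegral => s; rewrite inE /= in_itv /= => /andP[s0 st].
  by rewrite /w /gamma /concat (le_lt_trans st ttau).
rewrite {1}/w /concat ltNge taut /= (Rintegral_itv_split tau0 taut iw).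
have ttau0 : 0 <= t - tau by rewrite subr_ge0.
have [iv ->] := hv.2 _ ttau0 i.
have [iy ->] := hy.2 tau tau0 i; rewrite -addrA; congr (_ + (_ + _)).
  (* At [tau] the second control is already in force, so the integrands are compared on the
     half-open interval; the endpoint is negligible. *)
  have sub : `[0, tau[ `<=` (`[0, tau] : set R).
    by move=> s /=; rewrite !in_itv /= => /andP[-> /ltW].
  rewrite -[LHS]Rintegral_itv_bndo_bndc; last exact: integrableS iy.
  rewrite -[RHS]Rintegral_itv_bndo_bndc; last first.
    apply: integrableS iw => // s /=; rewrite !in_itv /= => /andP[-> h].
    by rewrite (le_trans (ltW h)).
  apply: eq_Rintegral => s; rewrite inE /= in_itv /= => /andP[s0 st].
  by rewrite /w /gamma /concat st.
rewrite /Rintegral (integral_shift tau (D := `[tau, t]%classic)) //; last first.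
  apply/measurable_EFinP.
  apply: (measurable_fun_segment _ tau0).
  apply: (measurable_dynamics f_cont _ hg) => j; exact: measurable_coord.
congr fine; rewrite (_ : [set s : R | _] = `[0, t - tau]%classic).
  apply: eq_integral => s; rewrite inE /= in_itv /= => /andP[s0 _].
  by rewrite /w /gamma /concat ltNge lerDr s0 /= addrK.
by apply/seteqP; split => s /=; rewrite !in_itv /= lerDr lerBrDr.
Qed.

End ControlledTrajectories.

(** * Exit times and concatenation of controls *)

Section DistanceToSet.
Context {R : realType} {n : nat}.
Implicit Types (T : set 'rV[R]_n) (v : 'rV[R]_n).

(** The strict inequality yields an actual point of [T] without asking that the infimum in [dist] be
    attained. *)
Definition within_dist T (d : R) v := exists2 p, T p & enorm (v - p) < d.

Lemma dist_ge0 T v : (0 <= dist T v)%E.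
Proof. by apply/ereal_infP => _ [p _ <-]; rewrite lee_fin enorm_ge0. Qed.

Lemma dist_ltP T v (d : R) : (dist T v < d%:E)%E <-> within_dist T d v.
Proof.
split=> [/ereal_inf_lt[_ [p Tp <-]]|[p Tp]]; first by rewrite lte_fin; exists p.
by rewrite -lte_fin; apply: le_lt_trans; apply: ereal_inf_lbound; exists p.
Qed.

(** For an empty [T] the distance is infinite and [fine] sends it to 0, hence the nonemptiness
    assumption. *)
Lemma not_within_dist T v (d : R) : T !=set0 -> ~ within_dist T d v -> d <= fine (dist T v).
Proof.
move=> [p Tp] hv.
have fd : dist T v \is a fin_num.
  rewrite ge0_fin_numE ?dist_ge0//; apply: le_lt_trans (ltry (enorm (v - p))).
  by apply: ereal_inf_lbound; exists p.
by rewrite -lee_fin fineK// leNgt; apply/negP => /dist_ltP.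
Qed.

End DistanceToSet.

Section ExitTime.
Context {R : realType} {n m : nat}.
Variables (A : set 'rV[R]_m) (T : set 'rV[R]_n).
Variables (f : 'rV[R]_n -> 'rV[R]_m -> 'rV[R]_n) (l : 'rV[R]_n -> 'rV[R]_m -> R).
Notation mu := (@lebesgue_measure R).
Notation halfline := (`[0, +oo[%classic : set R).
Hypothesis T_closed : closed T.
Hypothesis f_cont : {within [set p : 'rV[R]_n * 'rV[R]_m | A p.2],
  continuous (fun p => f p.1 p.2)}.
Hypothesis l_cont : {within [set p : 'rV[R]_n * 'rV[R]_m | A p.2],
  continuous (fun p => l p.1 p.2)}.
Hypothesis l_ge0 : forall x a, A a -> 0 <= l x a.
Variable M : R.
Hypothesis M_gt0 : 0 < M.
Hypothesis f_growth : forall x a, A a -> `|f x a| <= M * (1 + `|x|).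
Hypothesis f_lip : forall r : R, 0 < r -> exists2 L : R, 0 < L &
  forall x1 x2 a, `|x1| <= r -> `|x2| <= r -> A a ->
    `|f x1 a - f x2 a| <= L * `|x1 - x2|.

Implicit Types (x : 'rV[R]_n) (alpha beta : R -> 'rV[R]_m) (t s e : R).
Notation tr := (trajectory f).
Notation exit := (exit_time f T).

Lemma exit_time_ge0 x alpha : (0 <= exit x alpha)%E.
Proof. by apply/ereal_infP => _ [t [t0 _] <-]; rewrite lee_fin. Qed.

Lemma exit_time_le x alpha t : 0 <= t -> T (tr x alpha t) -> (exit x alpha <= t%:E)%E.
Proof. by move=> t0 Tt; apply: ereal_inf_lbound; exists t. Qed.

Lemma before_exit x alpha t : 0 <= t -> (t%:E < exit x alpha)%E -> ~ T (tr x alpha t).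
Proof. by move=> t0 + Tt; rewrite ltNge exit_time_le. Qed.

Lemma trajectory_stays_out x alpha t : is_control A alpha -> 0 <= t ->
  ~ T (tr x alpha t) ->
  exists2 e, 0 < e & forall s, 0 <= s -> `|s - t| < e -> ~ T (tr x alpha s).
Proof.
move=> ha t0 Tt; have [cy _] := trajectoryP f_cont M_gt0 f_growth f_lip x ha.
have : \forall v \near nbhs (tr x alpha t), (~` T) v.
  by apply: open_nbhs_nbhs; split => //; exact: closed_openC.
have /subspace_continuousP/(_ t) := cy; rewrite /= in_itv /= andbT => /(_ t0) c.
move=> /c /nbhs_ballP[e /= e0 he]; exists e => // s s0 st.
by apply: (he s); rewrite ?in_itv /= ?andbT// /ball /= distrC.
Qed.

Lemma exit_time_gt0 x alpha : is_control A alpha -> ~ T x -> (0 < exit x alpha)%E.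
Proof.
move=> ha Tx; have sol := trajectoryP f_cont M_gt0 f_growth f_lip x ha.
have T0 : ~ T (tr x alpha 0) by rewrite (solution0 sol).
have [e e0 he] := trajectory_stays_out ha (lexx 0) T0.
apply: (@lt_le_trans _ _ e%:E); first by rewrite lte_fin.
apply/ereal_infP => _ [t [t0 Tt] <-]; rewrite lee_fin leNgt; apply/negP => te.
by apply: (he t) => //; rewrite subr0 ger0_norm.
Qed.

(** The infimum is attained: off the closed set [T] at time [e], the trajectory would stay off it
    for a while after [e], whereas hitting times come arbitrarily close to [e]. *)
Lemma exit_time_in x alpha e : is_control A alpha -> exit x alpha = e%:E ->
  T (tr x alpha e).
Proof.
move=> ha ee; apply: contrapT => Te.
have e0 : 0 <= e by rewrite -lee_fin -ee exit_time_ge0.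
have [d d0 hd] := trajectory_stays_out ha e0 Te.
have /ereal_inf_lt[_ [t [t0 Tt] <-]] : (exit x alpha < (e + d)%:E)%E.
  by rewrite ee lte_fin ltrDl.
rewrite lte_fin => ted.
have : (exit x alpha <= t%:E)%E by exact: exit_time_le.
rewrite ee lee_fin => et; apply: (hd t) => //.
by rewrite ger0_norm ?subr_ge0// ltrBlDl.
Qed.

(** A single description of the filter for finite and infinite exit times; positivity of [tx] makes
    room for a nonnegative [s]. *)
Lemma left_nbhsP (tx : \bar R) (V : set R) : (0 < tx)%E ->
  left_nbhs tx V <-> exists s, [/\ 0 <= s, (s%:E < tx)%E &
    forall t, s < t -> (t%:E < tx)%E -> V t].
Proof.
case: tx => [r| |]//= tx0.
  rewrite lte_fin in tx0; split=> [/nbhs_ballP[e /= e0 he]|[s [s0 sr hs]]].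
    exists (Num.max 0 (r - e)); split; first by rewrite le_max lexx.
      by rewrite lte_fin gt_max tx0 ltrBlDr ltrDl.
    move=> t; rewrite gt_max lte_fin => /andP[t0 tre] tr.
    by apply: he => //=; rewrite /ball /= ger0_norm ?subr_ge0 ?ltW//; lra.
  rewrite lte_fin in sr; apply/nbhs_ballP; exists (r - s); first by rewrite /= subr_gt0.
  move=> t; rewrite /ball /= => rt tr; apply: hs; last by rewrite lte_fin.
  by move: rt; rewrite gtr0_norm ?subr_gt0//; lra.
split=> [[M0 [M0r hM]]|[s [s0 _ hs]]].
  exists (Num.max 0 M0); split=> //; first by rewrite le_max lexx.
    by rewrite ltry.
  by move=> t; rewrite gt_max => /andP[_ /hM].
exists s; split; first exact: num_real.
by move=> t st; apply: hs => //; rewrite ltry.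
Qed.

(** As the distance is nonnegative, its lower limit vanishes exactly when arbitrarily small
    distances recur arbitrarily late before the exit. *)
Lemma admissibleP x alpha : ~ T x -> admissible A f T x alpha <->
  is_control A alpha /\ forall d s, 0 < d -> 0 <= s -> (s%:E < exit x alpha)%E ->
    exists t, [/\ s < t, (t%:E < exit x alpha)%E & within_dist T d (tr x alpha t)].
Proof.
move=> Tx; rewrite /admissible /= limf_einfE.
split=> [[ha h]|[ha h]]; split=> //; have ex0 := exit_time_gt0 ha Tx.
  move=> d s d0 s0 sx.
  pose V := [set t | s < t /\ (t%:E < exit x alpha)%E].
  have LV : left_nbhs (exit x alpha) V by apply/left_nbhsP => //; exists s.
  have : (ereal_inf [set dist T (tr x alpha t) | t in V] < d%:E)%E.
    apply: (@le_lt_trans _ _ 0%E); last by rewrite lte_fin.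
    by rewrite -h; apply: ereal_sup_ubound; exists V.
  by move=> /ereal_inf_lt[_ [t [st tx] <-]] /dist_ltP; exists t.
apply/eqP; rewrite eq_le; apply/andP; split.
  apply/ereal_supP => _ [V /(left_nbhsP _ ex0)[s [s0 sx hs]] <-].
  apply/lee_addgt0Pr => d d0; rewrite add0e; have [t [st tx tT]] := h d s d0 s0 sx.
  apply: (@le_trans _ _ (dist T (tr x alpha t))); last exact/ltW/dist_ltP.
  by apply: ereal_inf_lbound; exists t => //; exact: hs.
apply: (@le_trans _ _ (ereal_inf [set dist T (tr x alpha t) | t in setT])).
  by apply/ereal_infP => _ [t _ <-]; exact: dist_ge0.
apply: ereal_sup_ubound; exists setT => //; apply/left_nbhsP => //.
by exists 0; split.
Qed.

Lemma hitting_admissible x alpha e : ~ T x -> is_control A alpha ->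
  exit x alpha = e%:E -> admissible A f T x alpha.
Proof.
move=> Tx ha ee; apply/admissibleP => //; split=> // d s d0 s0.
rewrite ee lte_fin => se; have Te := exit_time_in ha ee.
have sol := trajectoryP f_cont M_gt0 f_growth f_lip x ha.
have [B B0 hB] := solution_lipschitz M_gt0 f_growth e ha sol.
have D0 : 0 < n%:R * B + 1 by rewrite ltr_wpDl// mulr_ge0.
(* The midpoint puts [t] after [s]; the second term puts it so close to [e] that the speed bound
   [B], times the norm factor [n], leaves a displacement below [d]. *)
pose t := Num.max ((s + e) / 2) (e - d / (n%:R * B + 1) / 2).
have dD : 0 < d / (n%:R * B + 1) by rewrite divr_gt0.
have te : t < e by rewrite /t gt_max; apply/andP; split; lra.
have st : s < t by rewrite /t lt_max; apply/orP; left; lra.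
have t0 : 0 <= t by rewrite (le_trans s0)// ltW.
have etd : e - t < d / (n%:R * B + 1).
  have : e - d / (n%:R * B + 1) / 2 <= t by rewrite /t le_max lexx orbT.
  by move: dD; set q := d / _ => ? ?; lra.
exists t; split; rewrite ?lte_fin//; exists (tr x alpha e) => //.
rewrite (le_lt_trans (ler_enorm_norm _))// distrC.
apply: (@le_lt_trans _ _ (n%:R * (B * (e - t)))).
  by apply: ler_wpM2l => //; apply: hB => //; exact: ltW.
rewrite ltr_pdivlMr// in etd; apply: le_lt_trans etd.
by rewrite mulrA mulrC ler_wpM2l ?subr_ge0 ?(ltW te)// lerDl.
Qed.

Lemma measurable_running_cost x alpha : is_control A alpha ->
  measurable_fun halfline (fun t => l (tr x alpha t) (alpha t)).
Proof.
move=> ha; apply: (measurable_comp_within _ _ ha.2 l_cont) => //.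
  move=> i; apply: measurable_coord.
  by case: (trajectoryP f_cont M_gt0 f_growth f_lip x ha).
by move=> t /=; rewrite in_itv /= andbT; exact: ha.1.
Qed.

Lemma measurable_before (tx : \bar R) :
  measurable ([set t : R | 0 <= t /\ (t%:E < tx)%E] : set R).
Proof.
case: tx => [r| |].
- rewrite (_ : [set _ | _] = `[0, r[%classic)//.
  by apply/seteqP; split => t /=; rewrite in_itv /= lte_fin; [move=> [-> ->]|case/andP].
- rewrite (_ : [set _ | _] = `[0, +oo[%classic)//.
  by apply/seteqP; split => t /=; rewrite in_itv /= andbT ltry // => -[].
- rewrite (_ : [set _ | _] = set0)//.
  by apply/seteqP; split => t //= [_]; rewrite ltNge leNye.
Qed.

(** The remaining time [e] is extended-valued so that controls reaching the target only
    asymptotically are covered. *)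
Lemma ge0_integral_concat (F G H : R -> \bar R) (tau : R) (e : \bar R) :
  0 <= tau -> (0 <= e)%E -> measurable_fun halfline F ->
  (forall t, 0 <= t -> (0 <= F t)%E) ->
  (forall t, 0 <= t -> t < tau -> F t = G t) ->
  (forall t, 0 <= t -> F (t + tau) = H t) ->
  (\int[mu]_(t in [set t : R | (0 <= t)%R /\ (t%:E < e + tau%:E)%E]) F t =
   \int[mu]_(t in (`[0%R, tau[%classic : set R)) G t +
   \int[mu]_(t in [set t : R | (0 <= t)%R /\ (t%:E < e)%E]) H t)%E.
Proof.
move=> tau0 e0 mF F0 FG FH.
pose D : set R := [set t | tau <= t /\ (t%:E < e + tau%:E)%E].
have D0 t : D t -> 0 <= t by case=> taut _; exact: le_trans taut.
have DE : [set t : R | 0 <= t /\ (t%:E < e + tau%:E)%E] = `[0, tau[ `|` D.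
  apply/seteqP; split => t /=; rewrite in_itv /=.
    by move=> [t0 tx]; have [|taut] := ltP t tau; [left; rewrite t0|right].
  move=> [/andP[t0 tt]|/[dup] /D0 t0 [_ tx]]; split => //.
  by rewrite (@lt_le_trans _ _ tau%:E) ?lte_fin// leeDr.
have DD : [set t : R | D (t + tau)] = [set t : R | 0 <= t /\ (t%:E < e)%E].
  by apply/seteqP; split => t /=; rewrite /D /= lerDr EFinD lteD2rE.
have mDD : measurable D.
  rewrite (_ : D = [set t : R | 0 <= t /\ (t%:E < e + tau%:E)%E] `&` `[tau, +oo[%classic).
    by apply: measurableI => //; exact: measurable_before.
  apply/seteqP; split => t /=; rewrite in_itv /= andbT.
    by move=> Dt; split; [split; [exact: D0|case: Dt]|case: Dt].
  by move=> [[_ tx] taut]; split.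
have mDF : measurable_fun D F.
  by apply: measurable_funS mF => // t /D0; rewrite /= in_itv /= andbT.
rewrite DE ge0_integral_setU//.
- congr (_ + _)%E.
    by apply: eq_integral => t; rewrite inE /= in_itv /= => /andP[]; exact: FG.
  rewrite (ge0_integral_shift tau mDD)//; last by move=> t /D0; exact: F0.
  by rewrite DD; apply: eq_integral => t; rewrite inE /= => -[t0 _]; exact: FH.
- apply/measurable_funU => //; split=> //.
  by apply: measurable_funS mF => // t /=; rewrite !in_itv /= andbT => /andP[].
- move=> t; rewrite -DE => -[t0 _]; exact: F0.
- apply/disj_setPS => t /= [] + []; rewrite in_itv /= => /andP[_ tt].
  by rewrite leNgt tt.
Qed.

Lemma value_le_cost x alpha : ~ T x -> admissible A f T x alpha ->
  (value A f l T x <= cost f l T x alpha)%E.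
Proof.
move=> Tx adm; rewrite /value; case: asboolP => // _.
by apply: ereal_inf_lbound; exists alpha.
Qed.

Section Concatenation.
Variables (x : 'rV[R]_n) (alpha beta : R -> 'rV[R]_m) (tau : R).
Hypothesis tau_ge0 : 0 <= tau.
Hypothesis alpha_control : is_control A alpha.
Hypothesis stays_out : forall s, 0 <= s <= tau -> ~ T (tr x alpha s).
Let w := tr x alpha tau.
Hypothesis beta_admissible : admissible A f T w beta.
Let gamma := concat tau alpha beta.

Let beta_control : is_control A beta. Proof. by case: beta_admissible. Qed.

Let gamma_control : is_control A gamma. Proof. exact: concat_control. Qed.

(** Uniqueness identifies the solution selected by [trajectory] with the glued one. *)
Let concat_trajectory t : 0 <= t ->
  tr x gamma t = concat tau (tr x alpha) (tr w beta) t.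
Proof.
apply: (trajectory_unique f_cont M_gt0 f_growth f_lip gamma_control).
apply: (concat_solution f_cont M_gt0 f_growth) => //.
  exact: (trajectoryP f_cont M_gt0 f_growth f_lip).
exact: (trajectoryP f_cont M_gt0 f_growth f_lip).
Qed.

Let concat_before t : 0 <= t -> t < tau -> tr x gamma t = tr x alpha t.
Proof. by move=> t0 tt; rewrite concat_trajectory// /concat tt. Qed.

Let concat_after t : 0 <= t -> tr x gamma (t + tau) = tr w beta t.
Proof.
by move=> t0; rewrite concat_trajectory ?addr_ge0// /concat ltNge lerDr t0 /= addrK.
Qed.

Let x_out : ~ T x.
Proof.
have := stays_out (s := 0); rewrite lexx tau_ge0 => /(_ isT).
by rewrite (solution0 (trajectoryP f_cont M_gt0 f_growth f_lip x alpha_control)).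
Qed.

Let w_out : ~ T w. Proof. by apply: stays_out; rewrite tau_ge0 lexx. Qed.

(** [stays_out] excludes hits before [tau]; later hits are those of the second piece, shifted by
    [tau]. *)
Let exit_concat : exit x gamma = (exit w beta + tau%:E)%E.
Proof.
apply/eqP; rewrite eq_le; apply/andP; split.
  rewrite -leeBlDr//; apply/ereal_infP => _ [t [t0 Tt] <-].
  rewrite leeBlDr// -EFinD; apply: exit_time_le; first by rewrite addr_ge0.
  by rewrite concat_after.
apply/ereal_infP => _ [t [t0 Tt] <-].
have [ttau|taut] := ltP t tau.
  by move: Tt; rewrite concat_before// => /stays_out; rewrite t0 ltW//; case.
rewrite -leeBrDr// -EFinB; apply: exit_time_le; rewrite ?subr_ge0//.
by rewrite -concat_after ?subr_ge0// subrK.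
Qed.

Let gamma_admissible : admissible A f T x gamma.
Proof.
apply/admissibleP => //; split=> // d s d0 s0; rewrite exit_concat => sx.
have [_ hb] := (admissibleP _ w_out).1 beta_admissible.
have h0 : 0 <= Num.max 0 (s - tau) by rewrite le_max lexx.
have h1 : ((Num.max 0 (s - tau))%:E < exit w beta)%E.
  rewrite EFin_max gt_max (exit_time_gt0 beta_control w_out) /=.
  by rewrite EFinB lteBlDr.
have [t [st tx tT]] := hb d _ d0 h0 h1.
move: st; rewrite gt_max => /andP[t0 st]; exists (t + tau); split.
- by rewrite -ltrBlDr.
- by rewrite EFinD lteD2rE.
- by rewrite concat_after// ltW.
Qed.

Let cost_concat : cost f l T x gamma =
  (\int[mu]_(t in (`[0%R, tau[%classic : set R)) (l (tr x alpha t) (alpha t))%:E +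
   cost f l T w beta)%E.
Proof.
rewrite /cost exit_concat.
apply: (ge0_integral_concat tau_ge0 (exit_time_ge0 w beta)).
- by apply/measurable_EFinP; exact: measurable_running_cost.
- by move=> t t0; rewrite lee_fin; exact: l_ge0 (gamma_control.1 t t0).
- by move=> t t0 tt; rewrite (concat_before t0 tt) /gamma /concat tt.
- by move=> t t0; rewrite (concat_after t0) /gamma /concat ltNge lerDr t0 /= addrK.
Qed.

(** The inequality of dynamic programming that comes from suboptimality of a switched control. *)
Lemma value_le_concat : (value A f l T x <=
  \int[mu]_(t in (`[0%R, tau[%classic : set R)) (l (tr x alpha t) (alpha t))%:E +
  cost f l T w beta)%E.
Proof. by rewrite -cost_concat; exact: value_le_cost. Qed.

End Concatenation.

End ExitTime.

(** * The boundary of the target *)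

Section TargetBoundary.
Context {R : realType} {n : nat}.
Implicit Types (T : set 'rV[R]_n) (p q : 'rV[R]_n).

(** The boundary point is the last point of [T] on the segment from [q] to [p]: were it interior,
    the segment would still be in [T] slightly later. *)
Lemma segment_hits_boundary T p q : closed T -> T q -> ~ T p ->
  exists2 b, boundary T b & `|p - b| <= `|p - q|.
Proof.
move=> clT Tq Tp; pose g (s : R) := q + s *: (p - q).
have cg : continuous g.
  move=> s; apply: cvgD; first exact: cvg_cst.
  by apply: cvgZl; exact: cvg_id.
pose S := `[0, 1]%classic `&` (g @^-1` T).
have cS : compact S.
  apply: compact_closedI; first exact: segment_compact.
  by apply: closed_comp => // s _; exact: cg.
have S0 : S !=set0.
  by exists 0; split; rewrite /= ?in_itv /= ?lexx ?ler01// /g scale0r addr0.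
have cid : continuous (@id R) by move=> z; exact: cvg_id.
have [s] := @compact_EVT_max _ _ id S S0 cS (continuous_subspaceT cid).
rewrite inE => -[/=]; rewrite in_itv /= => /andP[s0 s1] Ts smax.
have g1 : g 1 = p by rewrite /g scale1r addrC subrK.
have slt1 : s < 1.
  by rewrite lt_neqAle s1 andbT; apply/eqP => se; apply: Tp; rewrite -g1 -se.
exists (g s).
  split; first exact: subset_closure.
  rewrite /interior => /(cg s) /nbhs_ballP[e /= e0 he].
  pose r := s + Num.min (e / 2) (1 - s).
  have mn0 : 0 < Num.min (e / 2) (1 - s) by rewrite lt_min divr_gt0//= subr_gt0.
  have Sr : S r.
    split; first rewrite /= in_itv /= /r addr_ge0 ?(ltW mn0)//=.
      by rewrite -lerBrDl ge_min lexx orbT.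
    apply: he; rewrite /ball /= /r opprD addrA subrr add0r normrN gtr0_norm//.
    by rewrite gt_min; apply/orP; left; lra.
  have := smax r; rewrite inE => /(_ Sr); rewrite /r => H.
  by move: mn0; rewrite ltNge -(lerD2l s) addr0 H.
rewrite (_ : p - g s = (1 - s) *: (p - q)); last first.
  by rewrite /g scalerBl scale1r opprD addrA.
rewrite normrZ ger0_norm ?subr_ge0//.
by rewrite ler_piMl// lerBlDr lerDl.
Qed.

(** Compactness of the boundary turns pointwise continuity into one radius [d]. A point outside [T]
    that is close to [T] is at least as close to the boundary, by the segment argument. *)
Lemma small_near_target T (V : 'rV[R]_n -> \bar R) (e : R) :
  closed T -> compact (boundary T) -> (forall x, T x -> V x = 0%E) ->
  (forall x, boundary T x -> continuous_at_in (~` interior T) V x) -> 0 < e ->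
  exists2 d, 0 < d & forall p q, ~ T p -> T q -> `|p - q| < d -> (V p < e%:E)%E.
Proof.
move=> clT cbT VT Vc e0.
pose P (d : R) b := forall p, ~ T p -> `|p - b| < d -> (V p < e%:E)%E.
have [d [d0 hd]] : exists d, 0 < d /\ boundary T `<=` P d.
  have : \forall d \near (0 : R)^'+, boundary T `<=` P d.
    move/compact_near_coveringP : cbT; apply => b bb.
    have Tb : T b by case: bb; rewrite -(proj1 (closure_id T) clT).
    have : \forall z \near within (~` interior T) (nbhs b), (V z < e%:E)%E.
      apply: (Vc b bb [set v | (v < e%:E)%E]); rewrite VT//.
      by apply: open_nbhs_nbhs; split; [exact: open_ereal_lt_ereal|rewrite /= lte_fin].
    move=> /nbhs_ballP[r /= r0 hr].
    (* Half of the radius is spent on moving the centre from [b] to [b'], the other half bounds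
       [d]. *)
    have r2 : 0 < r / 2 by rewrite divr_gt0.
    near=> b' d.
    have bb' : `|b - b'| < r / 2.
      near: b'; apply/nbhs_ballP; exists (r / 2) => // z.
      by rewrite -ball_normE.
    have dr : d <= r / 2 by near: d; exact: nbhs_right_le.
    move=> p Tp pb'; apply: hr; last by move/interior_subset.
    rewrite -ball_normE /= (_ : b - p = (b - b') - (p - b')); last first.
      by rewrite opprB addrA subrK.
    rewrite (le_lt_trans (ler_normB _ _))// [ltRHS]splitr ltrD//.
    exact: lt_le_trans dr.
  move=> h; near (0 : R)^'+ => d; exists d; split; first by near: d; exact: nbhs_right_gt.
  by near: d.
exists d => // p q Tp Tq pq.
have [b bb pb] := segment_hits_boundary clT Tq Tp.
by apply: (hd b bb p Tp); exact: le_lt_trans pq.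
Unshelve. all: by end_near. Qed.

End TargetBoundary.

Section DiniBound.
Context {R : realType}.

(* Only a one-sided local bound on increments is available along a trajectory,
   which need not be differentiable anywhere. *)
Lemma increment_le (g : R -> R) (c b : R) : 0 <= b ->
  (forall t e, 0 <= t <= b -> 0 < e -> exists2 h, 0 < h &
    forall s, 0 <= s <= b -> `|s - t| < h -> `|g s - g t| < e) ->
  (forall t e, 0 <= t -> t < b -> 0 < e -> exists2 h, 0 < h &
    forall s, t < s -> s < t + h -> s <= b -> g s - g t <= (c + e) * (s - t)) ->
  g b - g 0 <= c * b.
Proof.
move=> b0 cg loc; apply/ler_addgt0Pr => e e0.
pose d := e / (b + 1).
have b1 : 0 < b + 1 by rewrite ltr_wpDl.
have d0 : 0 < d by rewrite divr_gt0.
have db : d * b <= e by rewrite /d -mulrA ler_piMr ?(ltW e0)// mulrC ler_pdivrMr// mul1r lerDl.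
(* Continuity of [g] puts the supremum of [S] in [S]; were it below [b], the local bound would
   produce a larger element. The extra slope [d] costs at most [e] over [0, b]. *)
pose S := [set s | 0 <= s <= b /\ g s - g 0 <= (c + d) * s].
have S0 : S 0 by split; rewrite ?lexx// subrr mulr0.
have Sb s : S s -> s <= b by case=> /andP[].
have uS : has_ubound S by exists b => s /Sb.
have sS : has_sup S by split; [exists 0|].
set t := sup S.
have t0 : 0 <= t by exact: ub_le_sup.
have tb : t <= b by apply: ge_sup => //; exists 0.
have St : g t - g 0 <= (c + d) * t.
  apply/ler_addgt0Pr => k k0.
  have k3 : 0 < k / 2 by lra.
  have t0b : 0 <= t <= b by rewrite t0.
  have [h h0 hh] := cg t (k / 2) t0b k3.
  have cd : 0 < `|c + d| + 1 by rewrite ltr_wpDl.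
  have m0 : 0 < Num.min h (k / 2 / (`|c + d| + 1)) by rewrite lt_min h0 divr_gt0.
  have [s [sb gs] ts] := sup_adherent m0 sS.
  have st : s <= t by apply: ub_le_sup => //; split.
  have ts2 : t - s < Num.min h (k / 2 / (`|c + d| + 1)) by rewrite -/t in ts; lra.
  rewrite lt_min ltr_pdivlMr// in ts2; case/andP: ts2 => ts1 ts2.
  have := hh s sb; rewrite distrC ger0_norm ?subr_ge0// => /(_ ts1).
  rewrite ltr_distl => /andP[h1 h2].
  have hn := ler_norm (- (c + d)); rewrite normrN in hn.
  have : 0 <= (`|c + d| + (c + d)) * (t - s) by rewrite mulr_ge0 ?subr_ge0//; lra.
  move: gs h1 h2 ts2 hn st; lra.
have [te|tlt] := eqVneq t b.
  by rewrite te in St; move: St db; rewrite mulrDl; lra.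
have {}tlt : t < b by rewrite lt_neqAle tlt.
have [h h0 hh] := loc t d t0 tlt d0.
pose s := t + Num.min (h / 2) (b - t).
have m0 : 0 < Num.min (h / 2) (b - t) by rewrite lt_min divr_gt0//= subr_gt0.
have m1 : Num.min (h / 2) (b - t) <= h / 2 by rewrite ge_min lexx.
have m2 : Num.min (h / 2) (b - t) <= b - t by rewrite ge_min lexx orbT.
have sb : s <= b by rewrite /s; lra.
have gs : g s - g t <= (c + d) * (s - t) by apply: hh => //; rewrite /s; lra.
have : s <= t.
  by apply: ub_le_sup => //; split; [rewrite /s addr_ge0// ltW|lra].
by rewrite /s; lra.
Qed.

End DiniBound.

(** * Time needed to approach the target *)

Section TimeToTarget.
Context {R : realType} {n m : nat}.
Variables (A : set 'rV[R]_m) (T : set 'rV[R]_n).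
Variables (f : 'rV[R]_n -> 'rV[R]_m -> 'rV[R]_n) (l : 'rV[R]_n -> 'rV[R]_m -> R).
Notation mu := (@lebesgue_measure R).
Hypothesis T_closed : closed T.
Hypothesis f_cont : {within [set p : 'rV[R]_n * 'rV[R]_m | A p.2],
  continuous (fun p => f p.1 p.2)}.
Hypothesis l_cont : {within [set p : 'rV[R]_n * 'rV[R]_m | A p.2],
  continuous (fun p => l p.1 p.2)}.
Hypothesis l_ge0 : forall x a, A a -> 0 <= l x a.
Variable M : R.
Hypothesis M_gt0 : 0 < M.
Hypothesis f_growth : forall x a, A a -> `|f x a| <= M * (1 + `|x|).
Hypothesis f_lip : forall r : R, 0 < r -> exists2 L : R, 0 < L &
  forall x1 x2 a, `|x1| <= r -> `|x2| <= r -> A a ->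
    `|f x1 a - f x2 a| <= L * `|x1 - x2|.

Implicit Types (x v : 'rV[R]_n) (alpha beta : R -> 'rV[R]_m) (t s e : R).
Notation tr := (trajectory f).
Notation exit := (exit_time f T).

Lemma dotp_Rintegral (D : set (measurableTypeR R)) v (g : R -> 'rV[R]_n) : measurable D ->
  (forall i, mu.-integrable D (EFin \o (fun s => g s 0 i))) ->
  mu.-integrable D (EFin \o (fun s => dotp v (g s))) /\
  \sum_i v 0 i * \int[mu]_(s in D) g s 0 i = \int[mu]_(s in D) dotp v (g s).
Proof.
move=> mD ig.
suff H (r : seq 'I_n) :
    mu.-integrable D (EFin \o (fun s => \sum_(i <- r) v 0 i * g s 0 i)) /\
    \sum_(i <- r) v 0 i * \int[mu]_(s in D) g s 0 i =
      \int[mu]_(s in D) \sum_(i <- r) v 0 i * g s 0 i by exact: H.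
elim: r => [|i r [IH1 IH2]].
  split.
    rewrite (_ : _ \o _ = cst 0%E); first exact: integrable0.
    by apply/funext => s /=; rewrite big_nil.
  rewrite big_nil (_ : (fun s => _) = cst 0); last first.
    by apply/funext => s; rewrite big_nil.
  by rewrite Rintegral_cst// mul0r.
have ii : mu.-integrable D (EFin \o (fun s => v 0 i * g s 0 i)).
  by have := integrableZl mD (v 0 i) (ig i); apply: eq_integrable.
have E : (fun s => \sum_(j <- i :: r) v 0 j * g s 0 j) =
    (fun s => v 0 i * g s 0 i + \sum_(j <- r) v 0 j * g s 0 j).
  by apply/funext => s; rewrite big_cons.
split; first by rewrite E; have := integrableD mD ii IH1; apply: eq_integrable.
by rewrite big_cons IH2 E RintegralD// RintegralZl.
Qed.

(** Off the closed set [T] the filter within the complement of the interior is the full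
    neighbourhood filter, so all three properties hold on a genuine ball. *)
Lemma C1_in_outside (U : 'rV[R]_n -> R) (G : 'rV[R]_n -> 'rV[R]_n) v e :
  C1_in (~` interior T) U G -> ~ T v -> 0 < e ->
  exists2 r, 0 < r & forall z, `|z - v| < r ->
    [/\ ~ T z, `|G z - G v| <= e & `|U z - U v - dotp (G v) (z - v)| <= e * enorm (z - v)].
Proof.
move=> [cG dU] Tv e0.
have Sv : (~` interior T) v by move/interior_subset.
have n1 : \forall z \near nbhs v, ~ T z.
  by apply: open_nbhs_nbhs; split=> //; exact: closed_openC.
have n2 : \forall z \near within (~` interior T) (nbhs v), `|G z - G v| <= e.
  have /subspace_continuousP/(_ v Sv)/cvgrPdist_le/(_ e e0) := cG.
  by apply: filterS => z; rewrite distrC.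
have n3 := dU v Sv e e0.
have /nbhs_ballP[r /= r0 hr] : \forall z \near nbhs v,
    [/\ ~ T z, `|G z - G v| <= e & `|U z - U v - dotp (G v) (z - v)| <= e * enorm (z - v)].
  near=> z.
  have Tz : ~ T z by near: z.
  have Sz : (~` interior T) z by move/interior_subset.
  by split=> //; move: Sz; near: z.
by exists r => // z zr; apply: hr; rewrite -ball_normE /= distrC.
Unshelve. all: by end_near. Qed.

Lemma C1_in_outside_continuous (U : 'rV[R]_n -> R) G v e :
  C1_in (~` interior T) U G -> ~ T v -> 0 < e ->
  exists2 r, 0 < r & forall z, `|z - v| < r -> `|U z - U v| < e.
Proof.
move=> hC Tv e0; have [r r0 hr] := C1_in_outside hC Tv ltr01.
have D0 : 0 < n%:R * (1 + `|G v|) + 1 by rewrite ltr_wpDl// mulr_ge0// addr_ge0.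
exists (Num.min r (e / (n%:R * (1 + `|G v|) + 1))).
  by rewrite lt_min r0 divr_gt0.
move=> z; rewrite lt_min ltr_pdivlMr// => /andP[/hr[_ _ h1] h2].
apply: le_lt_trans h2.
rewrite -[U z - U v](subrK (dotp (G v) (z - v))) (le_trans (ler_normD _ _))//.
rewrite (@le_trans _ _ (n%:R * `|z - v| + n%:R * (`|G v| * `|z - v|)))//.
  by rewrite lerD ?ler_norm_dotp// (le_trans h1)// mul1r ler_enorm_norm.
by have := normr_ge0 (z - v); lra.
Qed.

(** The chain rule is replaced by a one-sided increment bound: expand [U] at [y t] to first order,
    write [y s - y t] as an integral of the dynamics, and compare the gradient frozen at [y t] with
    the one along the path. *)
Lemma lyapunov_decrease (U : 'rV[R]_n -> R) G x alpha y b c :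
  C1_in (~` interior T) U G -> is_control A alpha -> is_solution f x alpha y -> 0 <= b ->
  (forall t, 0 <= t <= b -> ~ T (y t)) ->
  (forall t, 0 <= t <= b -> dotp (G (y t)) (f (y t) (alpha t)) <= c) ->
  U (y b) - U (y 0) <= c * b.
Proof.
move=> hC ha hy b0 yT yc.
have [B B0 fB] := solution_dynamics_bound M_gt0 f_growth b ha hy.
have [B' B'0 yB] := solution_lipschitz M_gt0 f_growth b ha hy.
have B1 : 0 < B' + 1 by rewrite ltr_wpDl.
have yB2 s t : 0 <= s <= b -> 0 <= t <= b -> `|y t - y s| <= B' * `|t - s|.
  move=> /andP[s0 sb] /andP[t0 tb]; have [st|/ltW ts] := leP s t.
    by rewrite (ger0_norm (_ : 0 <= t - s)) ?subr_ge0// yB.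
  by rewrite distrC [`|t - s|]distrC (ger0_norm (_ : 0 <= s - t)) ?subr_ge0// yB.
apply: (@increment_le _ (U \o y)) => //= [t e tb e0|t e t0 tb e0].
  have [r r0 hr] := C1_in_outside_continuous hC (yT t tb) e0.
  exists (r / (B' + 1)); first by rewrite divr_gt0.
  move=> s sb; rewrite ltr_pdivlMr// => st; apply: hr.
  apply: le_lt_trans st; rewrite (le_trans (yB2 _ _ tb sb))//.
  by rewrite mulrC ler_wpM2l// lerDl.
have tb' : 0 <= t <= b by rewrite t0 ltW.
(* Per unit of time, the remainder of the expansion costs [n * B'] and the freezing of the gradient
   [n * B], both times [e / D]; the total is at most [e]. *)
pose D := n%:R * (B + B') + 1.
have D0 : 0 < D by rewrite ltr_wpDl// mulr_ge0// addr_ge0.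
have [r r0 hr] := C1_in_outside hC (yT t tb') (divr_gt0 e0 D0).
exists (r / (B' + 1)); first by rewrite divr_gt0.
move=> s ts str sb.
have near_t q : t <= q -> q <= s -> `|y q - y t| < r.
  move=> tq qs; rewrite (le_lt_trans (yB t q t0 tq (le_trans qs sb)))//.
  have : (q - t) * (B' + 1) < r.
    by rewrite -ltr_pdivlMr//; lra.
  lra.
have [_ _ h1] := hr _ (near_t s (ltW ts) (lexx _)).
set e' := e / D in hr h1.
have e'0 : 0 <= e' by rewrite ltW// divr_gt0.
have st0 : 0 <= s - t by rewrite subr_ge0 ltW.
have h2 : e' * enorm (y s - y t) <= e' * (n%:R * (B' * (s - t))).
  rewrite ler_wpM2l// (le_trans (ler_enorm_norm _))// ler_wpM2l//.
  by rewrite yB// ltW.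
have h3 : dotp (G (y t)) (y s - y t) <= (c + n%:R * (e' * B)) * (s - t).
  have inc i := solution_increment i hy t0 (ltW ts).
  have [ii iE] := dotp_Rintegral (G (y t)) (measurable_itv _)
    (fun i => (inc i).1).
  rewrite (_ : dotp _ _ = \sum_i G (y t) 0 i *
    \int[mu]_(q in (`[t, s] : set R)) f (y q) (alpha q) 0 i); last first.
    by apply: eq_bigr => i _; rewrite !mxE (inc i).2.
  rewrite iE -Rintegral_cst_itv ?(ltW ts)//; apply: le_Rintegral => //.
    exact: (@bounded_integrable_itv _ _ _ _ `|c + n%:R * (e' * B)|).
  move=> q /=; rewrite in_itv /= => /andP[tq qs].
  have q0 : 0 <= q <= b by rewrite (le_trans t0 tq) (le_trans qs).
  have [_ Gq _] := hr _ (near_t q tq qs).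
  (* The assumed bound [c] concerns the gradient at [y q], the current point of the trajectory. *)
  rewrite -[G (y t)](subKr (G (y q))) dotpBl lerBlDr.
  rewrite (le_trans (yc q q0))// -addrA lerDl.
  have := ler_norm_dotp (G (y q) - G (y t)) (f (y q) (alpha q)).
  rewrite ler_norml => /andP[+ _].
  have : n%:R * (`|G (y q) - G (y t)| * `|f (y q) (alpha q)|) <= n%:R * (e' * B) :> R.
    by rewrite ler_wpM2l// ler_pM// fB.
  lra.
have h4 : e' * (n%:R * (B + B')) <= e.
  rewrite /e' -mulrA ler_piMr ?(ltW e0)// mulrC ler_pdivrMr// mul1r.
  by rewrite /D lerDl.
have h5 : e' * (n%:R * (B + B')) * (s - t) <= e * (s - t) by rewrite ler_wpM2r.
move: h1; rewrite ler_norml => /andP[_ h1].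
lra.
Qed.

(** An exit no later than [b] would fall in the first case, since admissibility gives a close
    approach before any exit. Admissibility also shows that [T] is nonempty, which makes
    [fine (dist T _)] meaningful. *)
Lemma reach_or_stay_away x alpha d b : ~ T x -> admissible A f T x alpha -> 0 < d -> 0 <= b ->
  (exists t, [/\ 0 <= t <= b, (t%:E < exit x alpha)%E & within_dist T d (tr x alpha t)]) \/
  (b%:E < exit x alpha)%E /\ forall t, 0 <= t <= b -> ~ T (tr x alpha t) /\
     d <= fine (dist T (tr x alpha t)).
Proof.
move=> Tx adm d0 b0.
have [ha hT] := (admissibleP T_closed f_cont M_gt0 f_growth f_lip alpha Tx).1 adm.
have ex0 := exit_time_gt0 T_closed f_cont M_gt0 f_growth f_lip ha Tx.
have [t [t0 tx tT]] := hT d 0 d0 (lexx _) ex0.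
have T0 : T !=set0 by case: tT => p Tp _; exists p.
have [?|no] := pselect (exists t, [/\ 0 <= t <= b, (t%:E < exit x alpha)%E &
  within_dist T d (tr x alpha t)]); [by left|right].
have bx : (b%:E < exit x alpha)%E.
  rewrite ltNge; apply/negP => xb; apply: no; exists t; split=> //.
  by rewrite (ltW t0) -lee_fin (le_trans (ltW tx)).
split=> // s /andP[s0 sb].
have sx : (s%:E < exit x alpha)%E by apply: le_lt_trans bx; rewrite lee_fin.
split; first exact: before_exit sx.
by apply: not_within_dist => // sT; apply: no; exists s; rewrite s0 sb.
Qed.

(** Staying at distance at least [d] up to time [b] costs at least [c d * b], which exceeds [C]; the
    summand 1 in [b] makes this strict. *)
Lemma reach_SC2 C d : SC2 A l T -> 0 < d -> 0 <= C ->
  exists2 b, 0 <= b & forall x alpha, ~ T x -> admissible A f T x alpha ->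
    (cost f l T x alpha <= C%:E)%E ->
    exists t, [/\ 0 <= t <= b, (t%:E < exit x alpha)%E & within_dist T d (tr x alpha t)].
Proof.
move=> [c [[cpos _ cmono] hc]] d0 C0; have cd := cpos d d0.
have b0 : 0 <= C / c d + 1 by rewrite addr_ge0// divr_ge0// ltW.
exists (C / c d + 1) => // x alpha Tx adm costC; set b := _ + 1.
have ha : is_control A alpha by case: adm.
have [//|[bx away]] := reach_or_stay_away Tx adm d0 b0.
exfalso; move: costC; apply/negP; rewrite -ltNge.
apply: (@lt_le_trans _ _ (c d * b)%:E).
  by rewrite lte_fin /b mulrDr mulrCA divff ?gt_eqF// !mulr1 ltrDl.
have sub : `[0, b]%classic `<=` [set t : R | 0 <= t /\ (t%:E < exit x alpha)%E].
  move=> t /=; rewrite in_itv /= => /andP[t0 tb]; split=> //.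
  by apply: le_lt_trans bx; rewrite lee_fin.
have mD := measurable_before (exit x alpha).
have ml : measurable_fun [set t : R | 0 <= t /\ (t%:E < exit x alpha)%E]
    (fun t => (l (tr x alpha t) (alpha t))%:E).
  apply/measurable_EFinP.
  apply: measurable_funS (measurable_running_cost f_cont l_cont M_gt0 f_growth f_lip x ha) => //.
  by move=> t /= [t0 _]; rewrite in_itv /= t0.
have -> : (c d * b)%:E = (\int[mu]_(t in `[0%R, b]%classic) (c d)%:E)%E.
  by rewrite integral_cst//= lebesgue_measure_itv /= lte_fin ltr_wpDl ?divr_ge0 ?(ltW cd)//
    oppr0 adde0.
apply: (@le_trans _ _ (\int[mu]_(t in `[0%R, b]%classic) (l (tr x alpha t) (alpha t))%:E)%E).
  apply: ge0_le_integral => //.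
  - by move=> t _; rewrite lee_fin ltW.
  - exact: (measurable_funS mD sub ml).
  - move=> t; rewrite /= in_itv /= => tb; have [Tt dt] := away t tb.
    case/andP: (tb) => t0 _; rewrite lee_fin (le_trans _ (hc _ _ Tt (ha.1 _ t0)))//.
    exact: cmono.
apply: ge0_subset_integral => // t [t0 _].
by rewrite lee_fin l_ge0//; exact: ha.1.
Qed.

(** Away from the target [U] falls at rate at least [c d]. Starting below [U x + 1], it would be
    negative at time [(U x + 1) / c d]. The bound is independent of the cost, but only local in the
    initial point. *)
Lemma reach_SC1 x d : SC1 A f T -> ~ T x -> 0 < d ->
  exists2 b, 0 <= b & exists2 r, 0 < r & forall z, `|z - x| < r -> ~ T z ->
    forall alpha, admissible A f T z alpha ->
    exists t, [/\ 0 <= t <= b, (t%:E < exit z alpha)%E & within_dist T d (tr z alpha t)].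
Proof.
move=> [U [G [c [U0 hC _ _ [[cpos _ cmono] hG]]]]] Tx d0; have cd := cpos d d0.
have Ux : 0 <= U x by apply: U0 => /interior_subset.
have [r r0 hr] := C1_in_outside_continuous hC Tx ltr01.
have b0 : 0 <= (U x + 1) / c d by rewrite divr_ge0 ?(ltW cd)// addr_ge0.
exists ((U x + 1) / c d) => //; set b := _ / _; exists r => // z zr Tz alpha adm.
have ha : is_control A alpha by case: adm.
have sol := trajectoryP f_cont M_gt0 f_growth f_lip z ha.
have [//|[bx away]] := reach_or_stay_away Tz adm d0 b0.
exfalso.
have : U (tr z alpha b) - U (tr z alpha 0) <= - c d * b.
  apply: (lyapunov_decrease hC ha sol b0) => t tb; have [Tt dt] := away t tb => //.
  case/andP: (tb) => t0 _; rewrite -lee_fin.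
  apply: (@le_trans _ _ (- c (fine (dist T (tr z alpha t))))%:E).
    apply: le_trans (hG _ Tt); apply: ereal_sup_ubound.
    by exists (alpha t) => //; exact: ha.1.
  by rewrite lee_fin lerN2 cmono.
have [|Tb _] := away b; first by rewrite b0 lexx.
have Ub : 0 <= U (tr z alpha b) by apply: U0 => /interior_subset.
rewrite (solution0 sol) mulNr /b [c d * _]mulrC divfK ?gt_eqF//.
by have := hr z zr; rewrite ltr_distl => /andP[_]; lra.
Qed.

Lemma reach x C d : SC1 A f T \/ SC2 A l T -> ~ T x -> 0 < d -> 0 <= C ->
  exists2 b, 0 <= b & exists2 r, 0 < r & forall z, `|z - x| < r -> ~ T z ->
    forall alpha, admissible A f T z alpha -> (cost f l T z alpha <= C%:E)%E ->
    exists t, [/\ 0 <= t <= b, (t%:E < exit z alpha)%E & within_dist T d (tr z alpha t)].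
Proof.
move=> [h1|h2] Tx d0 C0.
  have [b b0 [r r0 hr]] := reach_SC1 h1 Tx d0.
  by exists b => //; exists r => // z zr Tz alpha adm _; exact: hr.
have [b b0 hb] := reach_SC2 h2 d0 C0.
by exists b => //; exists 1 => // z _ Tz alpha; exact: hb.
Qed.

End TimeToTarget.

(** * The value function *)

Section ValueFunction.
Context {R : realType} {n m : nat}.
Variables (A : set 'rV[R]_m) (T : set 'rV[R]_n).
Variables (f : 'rV[R]_n -> 'rV[R]_m -> 'rV[R]_n) (l : 'rV[R]_n -> 'rV[R]_m -> R).
Notation mu := (@lebesgue_measure R).
Hypothesis T_closed : closed T.
Hypothesis f_cont : {within [set p : 'rV[R]_n * 'rV[R]_m | A p.2],
  continuous (fun p => f p.1 p.2)}.
Hypothesis l_cont : {within [set p : 'rV[R]_n * 'rV[R]_m | A p.2],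
  continuous (fun p => l p.1 p.2)}.
Hypothesis l_ge0 : forall x a, A a -> 0 <= l x a.
Variable M : R.
Hypothesis M_gt0 : 0 < M.
Hypothesis f_growth : forall x a, A a -> `|f x a| <= M * (1 + `|x|).
Hypothesis f_lip : forall r : R, 0 < r -> exists2 L : R, 0 < L &
  forall x1 x2 a, `|x1| <= r -> `|x2| <= r -> A a ->
    `|f x1 a - f x2 a| <= L * `|x1 - x2|.
Hypothesis l_lip : forall r : R, 0 < r -> exists2 L : R, 0 < L &
  forall x1 x2 a, `|x1| <= r -> `|x2| <= r -> A a ->
    `|l x1 a - l x2 a| <= L * `|x1 - x2|.

Implicit Types (x z : 'rV[R]_n) (alpha beta : R -> 'rV[R]_m) (t s e : R).
Notation tr := (trajectory f).
Notation exit := (exit_time f T).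
Notation V := (value A f l T).

Lemma cost_ge0 x alpha : is_control A alpha -> (0 <= cost f l T x alpha)%E.
Proof.
move=> ha; apply: integral_ge0 => t [t0 _].
by rewrite lee_fin l_ge0//; exact: ha.1.
Qed.

Lemma value_ge0 x : (0 <= V x)%E.
Proof.
rewrite /value; case: asboolP => // _.
by apply/ereal_infP => _ [alpha [ha _] <-]; exact: cost_ge0.
Qed.

Lemma value_lt_cost x (c : \bar R) : ~ T x -> (V x < c)%E ->
  exists2 alpha, admissible A f T x alpha & (cost f l T x alpha < c)%E.
Proof.
move=> Tx; rewrite /value; case: asboolP => // _.
by move=> /ereal_inf_lt[_ [alpha adm <-]]; exists alpha.
Qed.

Lemma trajectory_locally_bounded x b : exists2 r, 0 < r &
  forall z alpha t, `|z - x| < 1 -> is_control A alpha -> 0 <= t <= b ->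
    `|tr z alpha t| <= r.
Proof.
(* The a priori bound for [z], with [1 + |z|] replaced by [2 + |x|]. *)
pose r := 2 * (2 + `|x|) * expR (2 * M * b).
exists r; first by rewrite !mulr_gt0 ?expR_gt0// ltr_pwDl.
move=> z alpha t zx ha /andP[t0 tb].
have sol := trajectoryP f_cont M_gt0 f_growth f_lip z ha.
rewrite (@le_trans _ _ (1 + `|tr z alpha t|)) ?lerDr//.
rewrite (le_trans (solution_bound M_gt0 f_growth ha sol t0))// ler_pM ?expR_ge0//.
- rewrite ler_wpM2l//; have := ler_normD (z - x) x; rewrite subrK.
  by move: zx; lra.
- by rewrite ler_expR ler_wpM2l// mulr_ge0// ltW.
Qed.

Lemma trajectory_locally_lipschitz x b : exists2 k, 0 < k &
  forall z1 z2 alpha t, `|z1 - x| < 1 -> `|z2 - x| < 1 -> is_control A alpha ->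
    0 <= t <= b -> `|tr z1 alpha t - tr z2 alpha t| <= k * `|z1 - z2|.
Proof.
have [r r0 hr] := trajectory_locally_bounded x b.
have [L L0 fL] := f_lip r0.
exists (2 * expR (2 * L * b)); first by rewrite mulr_gt0 ?expR_gt0.
move=> z1 z2 alpha t h1 h2 ha tb.
have sol z := trajectoryP f_cont M_gt0 f_growth f_lip z ha.
have H := @solution_dependence _ _ _ A f z1 z2 alpha _ _ b r L ha (sol z1) (sol z2) L0 fL.
rewrite (le_trans (H _ t tb)) => [//|s sb|]; first by split; exact: hr.
rewrite mulrAC ler_wpM2r// ler_wpM2l// ler_expR ler_wpM2l ?mulr_ge0 ?(ltW L0)//.
by case/andP: tb.
Qed.

(** The domain [E] is general because it will be either the time before the exit from [z2] or the
    interval before a switch. *)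
Lemma running_cost_comparison z1 z2 alpha (E : set (measurableTypeR R)) b D :
  is_control A alpha -> measurable E -> 0 <= D -> 0 <= b ->
  (forall t, E t -> 0 <= t <= b /\ (t%:E < exit z1 alpha)%E) ->
  (forall t, 0 <= t <= b ->
    `|l (tr z1 alpha t) (alpha t) - l (tr z2 alpha t) (alpha t)| <= D) ->
  (\int[mu]_(t in E) (l (tr z2 alpha t) (alpha t))%:E <=
     cost f l T z1 alpha + (D * b)%:E)%E.
Proof.
move=> ha mE D0 b0 hE hl.
have E0 t : E t -> 0 <= t by case/hE => /andP[].
have ml z : measurable_fun E (fun t => (l (tr z alpha t) (alpha t))%:E).
  apply/measurable_EFinP.
  apply: measurable_funS (measurable_running_cost f_cont l_cont M_gt0 f_growth f_lip z ha) => //.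
  by move=> t /E0; rewrite /= in_itv /= andbT.
have l0 z t : E t -> (0 <= (l (tr z alpha t) (alpha t))%:E)%E.
  by move=> /E0 t0; rewrite lee_fin l_ge0//; exact: ha.1.
apply: (@le_trans _ _ (\int[mu]_(t in E) ((l (tr z1 alpha t) (alpha t))%:E + D%:E))%E).
  apply: ge0_le_integral => //.
  - by move=> t /l0.
  - exact: emeasurable_funD.
  - move=> t Et; rewrite -EFinD lee_fin; have [tb _] := hE t Et.
    by have := hl t tb; rewrite ler_distl => /andP[+ _]; lra.
rewrite ge0_integralD//; last by move=> t /l0.
apply: leeD.
  apply: ge0_subset_integral => //.
  - exact: measurable_before.
  - apply/measurable_EFinP.
    apply: measurable_funS (measurable_running_cost f_cont l_cont M_gt0 f_growth f_lip z1 ha) => //.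
    by move=> t [t0 _]; rewrite /= in_itv /= t0.
  - by move=> t [t0 _]; rewrite lee_fin l_ge0//; exact: ha.1.
  - by move=> t Et; split; [exact: E0|case: (hE t Et)].
rewrite integral_cst// EFinM lee_wpmul2l ?lee_fin//.
apply: (@le_trans _ _ (mu `[0%R, b]%classic)).
  by apply: le_measure; rewrite ?inE// => t /hE[tb _]; rewrite /= in_itv.
rewrite lebesgue_measure_itv /= lte_fin; case: ifP => // _.
by rewrite -EFinB subr0.
Qed.

(* Both semicontinuities at [x] are instances of this estimate: upper
   semicontinuity takes [z1 = x], lower semicontinuity (and the blow-up where
   [V x = +oo]) takes [z2 = x]. A near-optimal control for [z1] is followed from
   [z2] until the trajectory of [z1] is close to the target, a time bounded
   uniformly in [z1], and then replaced by one of small remaining cost. *)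
Lemma value_modulus x C e : SC1 A f T \/ SC2 A l T ->
  (forall k, 0 < k -> exists2 d, 0 < d &
    forall p q, ~ T p -> T q -> `|p - q| < d -> (V p < k%:E)%E) ->
  ~ T x -> 0 < e ->
  exists2 r, 0 < r & forall z1 z2, `|z1 - x| < r -> `|z2 - x| < r ->
    (V z1 <= C%:E)%E -> (V z2 <= V z1 + e%:E)%E.
Proof.
move=> hSC Vsmall Tx e0.
(* Three errors of [e / 4] are spent: near-optimality of [alpha], the change of running cost, and
   the cost after the switch. *)
have e4 : 0 < e / 4 by lra.
have [d d0 hd] := Vsmall _ e4.
have d2 : 0 < d / 2 by lra.
(* The cost bound is [|C| + e], as a near-optimal control for [z1] may cost slightly more than [C],
   and [reach] asks for a nonnegative bound. *)
have [b b0 [r r0 hr]] := reach T_closed f_cont l_cont l_ge0 M_gt0 f_growth f_lip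
  hSC Tx d2 (addr_ge0 (normr_ge0 C) (ltW e0)).
have [k k0 hk] := trajectory_locally_lipschitz x b.
have [B B0 hB] := trajectory_locally_bounded x b.
have [L L0 hL] := l_lip B0.
have /nbhs_ballP[r' /= r'0 hr'] : \forall z \near nbhs x, (~` T) z.
  by apply: open_nbhs_nbhs; split => //; exact: closed_openC.
(* With both points within [e / D] of [x], [|z1 - z2|] is below [2 * e / D], so the running costs
   differ by at most [e / 4] over time [b]. Likewise [d / (4 * k)] keeps the trajectories within
   [d / 2] of each other. *)
pose D := 8 * k * (L * b + 1).
have D0 : 0 < D by rewrite !mulr_gt0// ltr_wpDl// mulr_ge0// ltW.
exists (Num.min (Num.min 1 (Num.min r r')) (Num.min (d / (4 * k)) (e / D))).
  by rewrite !lt_min ltr01 r0 r'0 /= !divr_gt0// mulr_gt0.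
move=> z1 z2; rewrite !lt_min => /andP[/and3P[z11 z1r z1r'] /andP[z1d z1e]].
move=> /andP[/and3P[z21 z2r z2r'] /andP[z2d z2e]] VC.
have out z : `|z - x| < r' -> ~ T z.
  by move=> zx; apply: (hr' z); rewrite -ball_normE /= distrC.
have Tz1 := out _ z1r'; have Tz2 := out _ z2r'.
have zz : `|z1 - z2| <= `|z1 - x| + `|z2 - x|.
  by rewrite (_ : z1 - z2 = (z1 - x) - (z2 - x)) ?ler_normB// opprB addrA subrK.
have kd : k * `|z1 - z2| < d / 2.
  rewrite ltr_pdivlMr ?mulr_gt0// in z1d; rewrite ltr_pdivlMr ?mulr_gt0// in z2d.
  have : k * `|z1 - z2| <= k * (`|z1 - x| + `|z2 - x|) by rewrite ler_wpM2l// ltW.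
  by move: z1d z2d; lra.
have Lb : 0 <= L * b by rewrite mulr_ge0// ltW.
have ke : L * (k * `|z1 - z2|) * b <= e / 4.
  rewrite ltr_pdivlMr// /D in z1e; rewrite ltr_pdivlMr// /D in z2e.
  have h1 : k * `|z1 - z2| <= k * (`|z1 - x| + `|z2 - x|) by rewrite ler_wpM2l// ltW.
  have h2 : L * b * (k * `|z1 - z2|) <= (L * b + 1) * (k * (`|z1 - x| + `|z2 - x|)).
    by rewrite ler_pM// ?lerDl// mulr_ge0// ltW.
  by move: z1e z2e; lra.
have Vfin : V z1 \is a fin_num.
  by rewrite ge0_fin_numE ?value_ge0// (le_lt_trans VC)// ltry.
have [alpha adm costV] : exists2 alpha, admissible A f T z1 alpha &
    (cost f l T z1 alpha < V z1 + (e / 4)%:E)%E.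
  by apply: value_lt_cost => //; rewrite lteDl// lte_fin.
have ha : is_control A alpha by case: adm.
have costC : (cost f l T z1 alpha <= (`|C| + e)%:E)%E.
  rewrite (le_trans (ltW costV))// EFinD leeD//; last by rewrite lee_fin; lra.
  by rewrite (le_trans VC)// lee_fin ler_norm.
have [t [/andP[t0 tb] tx [p Tp yp]]] := hr z1 z1r Tz1 alpha adm costC.
have close s : 0 <= s <= b -> `|l (tr z1 alpha s) (alpha s) - l (tr z2 alpha s) (alpha s)|
    <= L * (k * `|z1 - z2|).
  move=> sb; case/andP: (sb) => s0 _.
  rewrite (le_trans (hL _ _ _ (hB _ _ _ z11 ha sb) (hB _ _ _ z21 ha sb) (ha.1 _ s0)))//.
  by rewrite ler_pM2l// hk.
have LK0 : 0 <= L * (k * `|z1 - z2|) by rewrite mulr_ge0 ?(ltW L0)// mulr_ge0// ltW.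
have compare (E : set (measurableTypeR R)) : measurable E ->
    (forall s, E s -> 0 <= s <= t) ->
    (\int[mu]_(s in E) (l (tr z2 alpha s) (alpha s))%:E <=
       V z1 + (e / 4)%:E + (e / 4)%:E)%E.
  move=> mE Et; apply: le_trans (running_cost_comparison ha mE LK0 b0 _ close) _.
    move=> s /Et/andP[s0 st]; rewrite s0 (le_trans st tb); split=> //.
    by apply: le_lt_trans tx; rewrite lee_fin.
  by apply: leeD; [exact: ltW|rewrite lee_fin].
have fold_e : (V z1 + (e / 4)%:E + (e / 4)%:E + (e / 4)%:E <= V z1 + e%:E)%E.
  by rewrite -!addeA -!EFinD leeD// lee_fin; lra.
(* If the second trajectory hits the target by time [t], its whole cost is accumulated before the
   first one exits, and no switch is made. *)
have [[s [/andP[s0 st] Ts]]|noT] := pselect (exists s, 0 <= s <= t /\ T (tr z2 alpha s)).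
  have exs : (exit z2 alpha <= s%:E)%E by exact: exit_time_le.
  have exf : exit z2 alpha \is a fin_num.
    by rewrite ge0_fin_numE ?exit_time_ge0// (le_lt_trans exs)// ltry.
  apply: (le_trans _ fold_e); apply: (@le_trans _ _ (V z1 + (e / 4)%:E + (e / 4)%:E)%E).
    apply: (@le_trans _ _ (cost f l T z2 alpha)).
      have adm2 := hitting_admissible T_closed f_cont M_gt0 f_growth f_lip Tz2 ha
        (esym (fineK exf)).
      exact: value_le_cost Tz2 adm2.
    apply: compare; first exact: measurable_before.
    by move=> q [q0 qx]; rewrite q0 -lee_fin (le_trans (ltW qx))// (le_trans exs)//.
  by rewrite -[leLHS]adde0 leeD// lee_fin ltW.
(* Otherwise [w] is within [d / 2 + d / 2] of the target point [p], where the value is below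
   [e / 4]. *)
pose w := tr z2 alpha t.
have Tw : ~ T w by move=> ?; apply: noT; exists t; rewrite t0 lexx.
have wp : `|w - p| < d.
  rewrite (_ : w - p = (tr z1 alpha t - p) - (tr z1 alpha t - w)); last first.
    by rewrite opprB [RHS]addrC addrA subrK.
  rewrite (le_lt_trans (ler_normB _ _))// [ltRHS]splitr ltrD//.
    by rewrite (le_lt_trans (ler_norm_enorm _)).
  by rewrite (le_lt_trans _ kd)// hk// t0 tb.
have [beta admb costb] := value_lt_cost Tw (hd _ _ Tw Tp wp).
apply: (le_trans _ fold_e).
apply: (le_trans (value_le_concat T_closed f_cont l_cont l_ge0 M_gt0 f_growth f_lip
  t0 ha _ admb)).
  by move=> s st Ts; apply: noT; exists s.
apply: leeD; last exact: ltW.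
apply: compare; first exact: measurable_itv.
by move=> s /=; rewrite in_itv /= => /andP[-> /ltW].
Qed.

End ValueFunction.

(** * From the local estimate to continuity and blow-up *)

Lemma continuity_from_modulus (R : realType) (n : nat) (T : set 'rV[R]_n)
    (V : 'rV[R]_n -> \bar R) (D := [set x | (~` interior T) x /\ (V x < +oo)%E]) :
  (forall x, (0 <= V x)%E) -> (forall x, T x -> V x = 0%E) ->
  (forall x, boundary T x -> continuous_at_in (~` interior T) V x) ->
  (forall x (C e : R), ~ T x -> 0 < e -> exists2 r, 0 < r & forall z1 z2,
    `|z1 - x| < r -> `|z2 - x| < r -> (V z1 <= C%:E)%E -> (V z2 <= V z1 + e%:E)%E) ->
  (forall x, D x -> continuous_at_in (~` interior T) V x) /\
  (forall x, rel_boundary (~` interior T) D x ->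
     V z @[z --> within (~` interior T) x^'] --> +oo%E).
Proof.
move=> V0 VT V_cont_bd modulus.
have V_cont x : D x -> continuous_at_in (~` interior T) V x.
  move=> [Sx Vx]; have [Tx|Tx] := pselect (T x).
    by apply: V_cont_bd; split=> //; exact: subset_closure.
  have Vfin : V x \is a fin_num by rewrite ge0_fin_numE.
  rewrite /continuous_at_in -(fineK Vfin) => N NV.
  have /nbhs_ballP[e /= e0 he] : nbhs (fine (V x)) (fun u => N u%:E) by exact: NV.
  (* With [d <= 1], the upper bound [V z <= V x + d] brings [V z] below the level [V x + 1], so the
     estimate can be applied again with [z] and [x] exchanged. *)
  pose d := Num.min 1 (e / 2).
  have d0 : 0 < d by rewrite lt_min ltr01 divr_gt0.
  have d1 : d <= 1 by rewrite ge_min lexx.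
  have de : d < e by rewrite gt_min; apply/orP; right; lra.
  have [r r0 hr] := modulus x (fine (V x) + 1) d Tx d0.
  apply: (@cvg_within _ (nbhs x)); apply/nbhs_ballP; exists r => //= z.
  rewrite -ball_normE /= => xz.
  have zx : `|z - x| < r by rewrite distrC.
  have xx : `|x - x| < r by rewrite subrr normr0.
  have h1 : (V z <= V x + d%:E)%E.
    by apply: hr => //; rewrite -[leLHS](fineK Vfin) lee_fin lerDl.
  have h2 : (V x <= V z + d%:E)%E.
    by apply: hr => //; rewrite (le_trans h1)// -[V x](fineK Vfin) -EFinD lee_fin lerD2l.
  have Vzfin : V z \is a fin_num.
    by rewrite ge0_fin_numE// (le_lt_trans h1)// -(fineK Vfin) -EFinD ltry.
  have {}h1 : fine (V z) <= fine (V x) + d by rewrite -lee_fin EFinD !fineK.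
  have {}h2 : fine (V x) <= fine (V z) + d by rewrite -lee_fin EFinD !fineK.
  rewrite /= -(fineK Vzfin); apply: he.
  by rewrite /ball /= (le_lt_trans _ de)// ler_distl; apply/andP; split; lra.
split=> // x [[Sx clD] clND].
(* A finite value would, by the continuity just proved, put a relative neighbourhood of [x] inside
   the domain, against [x] being a limit of points outside it. *)
have Vx : V x = +oo%E.
  apply/eqP; rewrite -leye_eq leNgt; apply/negP => Vx.
  have : \forall z \near within (~` interior T) (nbhs x), (V z < +oo)%E.
    apply: (V_cont x (conj Sx Vx) [set v | (v < +oo)%E]).
    by apply: open_nbhs_nbhs; split => //; exact: open_ereal_lt_ereal.
  by move=> /clND[z [[Sz nD] hz]]; apply: nD; split=> //; exact: hz.
have Tx : ~ T x by move=> /VT; rewrite Vx.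
apply/cvgeyPgt => C.
(* A nearby [z] with [V z <= C] would force [V x <= V z + 1], which is finite. *)
have [r r0 hr] := modulus x C 1 Tx ltr01.
apply: cvg_within; apply: cvg_within; apply/nbhs_ballP; exists r => //= z.
rewrite -ball_normE /= => xz; rewrite ltNge; apply/negP => Vz.
have zx : `|z - x| < r by rewrite distrC.
have xx : `|x - x| < r by rewrite subrr normr0.
have := hr z x zx xx Vz; rewrite Vx leye_eq.
have Vzfin : V z \is a fin_num by rewrite ge0_fin_numE// (le_lt_trans Vz)// ltry.
by rewrite -(fineK Vzfin).
Qed.

(** Passes from the Euclidean hypothesis to the sup norm; [n + 1] in place of [n] keeps the constant
    positive in dimension 0. *)
Lemma enorm_growth_norm (R : realType) (n : nat) (u x : 'rV[R]_n) (M : R) : 0 < M ->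
  enorm u <= M * (1 + enorm x) -> `|u| <= M * (n%:R + 1) * (1 + `|x|).
Proof.
move=> M0 h; rewrite (le_trans (ler_norm_enorm _))// (le_trans h)// -mulrA ler_pM2l//.
have := ler_enorm_norm x; have := normr_ge0 x; have : 0 <= n%:R :> R by [].
lra.
Qed.

Theorem proposition4p1 (R : realType) (n m : nat)
  (A : set 'rV[R]_m) (T : set 'rV[R]_n)
  (f : 'rV[R]_n -> 'rV[R]_m -> 'rV[R]_n) (l : 'rV[R]_n -> 'rV[R]_m -> R)
  (A_compact : compact A)
  (T_closed : closed T)
  (bdT_compact : compact (boundary T))
  (f_cont : {within [set p : 'rV[R]_n * 'rV[R]_m | A p.2],
               continuous (fun p => f p.1 p.2)})
  (l_cont : {within [set p : 'rV[R]_n * 'rV[R]_m | A p.2],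
               continuous (fun p => l p.1 p.2)})
  (l_ge0 : forall x a, A a -> 0 <= l x a)
  (f_growth : exists2 M : R, 0 < M &
     forall x a, A a -> enorm (f x a) <= M * (1 + enorm x))
  (fl_lipschitz : forall r : R, 0 < r -> exists2 L : R, 0 < L &
     forall x1 x2 a, enorm x1 <= r -> enorm x2 <= r -> A a ->
       enorm (f x1 a - f x2 a) <= L * enorm (x1 - x2) /\
       `|l x1 a - l x2 a| <= L * enorm (x1 - x2))
  (V_cont_bd : forall x, boundary T x ->
     continuous_at_in (~` interior T) (value A f l T) x)
  (hSC : SC1 A f T \/ SC2 A l T) :
  (forall x, Dom A f l T x ->
     continuous_at_in (~` interior T) (value A f l T) x) /\
  (forall x, rel_boundary (~` interior T) (Dom A f l T) x ->
     value A f l T z @[z --> within (~` interior T) x^'] --> +oo%E).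
Proof.
have [M M0 hM] := f_growth; pose M' := M * (n%:R + 1).
have n1 : 0 < n%:R + 1 :> R by rewrite ltr_wpDl.
have M'0 : 0 < M' by rewrite mulr_gt0.
have f_growth' x a : A a -> `|f x a| <= M' * (1 + `|x|).
  by move=> Aa; apply: enorm_growth_norm => //; exact: hM.
have lip r : 0 < r -> exists2 L : R, 0 < L & forall x1 x2 a, `|x1| <= r -> `|x2| <= r ->
    A a -> `|f x1 a - f x2 a| <= L * `|x1 - x2| /\ `|l x1 a - l x2 a| <= L * `|x1 - x2|.
  (* A Euclidean ball of radius [n * r] contains the sup-norm ball of radius [r]; the summand 1
     keeps the radius positive when [n] is 0. *)
  move=> r0; have [|L L0 hL] := fl_lipschitz (n%:R * r + 1).
    by rewrite ltr_wpDl// mulr_ge0// ltW.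
  exists (L * (n%:R + 1)); first by rewrite mulr_gt0.
  have en (x : 'rV[R]_n) : `|x| <= r -> enorm x <= n%:R * r + 1.
    move=> xr; rewrite (le_trans (ler_enorm_norm _))// ler_wpDr//.
    by rewrite ler_wpM2l.
  have Len (x : 'rV[R]_n) : L * enorm x <= L * (n%:R + 1) * `|x|.
    by rewrite -mulrA ler_pM2l// (le_trans (ler_enorm_norm _))// ler_wpM2r// lerDl.
  move=> x1 x2 a h1 h2 Aa; have [hf hl] := hL x1 x2 a (en _ h1) (en _ h2) Aa.
  by split; [rewrite (le_trans (ler_norm_enorm _))// (le_trans hf)|rewrite (le_trans hl)].
have f_lip r : 0 < r -> exists2 L : R, 0 < L & forall x1 x2 a, `|x1| <= r -> `|x2| <= r ->
    A a -> `|f x1 a - f x2 a| <= L * `|x1 - x2|.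
  by move=> /lip[L L0 hL]; exists L => // x1 x2 a h1 h2 Aa; have [] := hL x1 x2 a h1 h2 Aa.
have l_lip r : 0 < r -> exists2 L : R, 0 < L & forall x1 x2 a, `|x1| <= r -> `|x2| <= r ->
    A a -> `|l x1 a - l x2 a| <= L * `|x1 - x2|.
  by move=> /lip[L L0 hL]; exists L => // x1 x2 a h1 h2 Aa; have [] := hL x1 x2 a h1 h2 Aa.
set V := value A f l T.
have VT x : T x -> V x = 0%E by move=> Tx; rewrite /V /value; case: asboolP.
have V0 x : (0 <= V x)%E by exact: value_ge0.
have Vsmall k : 0 < k -> exists2 d, 0 < d &
    forall p q, ~ T p -> T q -> `|p - q| < d -> (V p < k%:E)%E.
  by move=> k0; exact: small_near_target.
have modulus x C e : ~ T x -> 0 < e -> exists2 r, 0 < r & forall z1 z2,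
    `|z1 - x| < r -> `|z2 - x| < r -> (V z1 <= C%:E)%E -> (V z2 <= V z1 + e%:E)%E.
  exact: (value_modulus T_closed f_cont l_cont l_ge0 M'0 f_growth' f_lip l_lip).
exact: continuity_from_modulus.
Qed.
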